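(* Let $f=\frac1n\sum_{i=1}^n f_i$ with $f_i:\mathbb{R}^d\to\mathbb{R}$ differentiable. Suppose that $f$ is $L$-smooth, that each $f_i$ is $L_i$-smooth with $L_{\max}=\max_{i} L_i$, that each $f_i$ is convex, and that $f$ is $\mu$-strongly convex with $\mu\ge 0$ and attains a minimum at some point $x^*\in\mathbb{R}^d$. Run the algorithm EF21-P + DIANA (described in the context) with compressors $\mathcal{C}_i^D\in\mathbb{U}(\omega)$ and $\mathcal{C}^P\in\mathbb{B}(\alpha)$, with $\beta=\frac{1}{\omega+1}$, $x^0=w^0$, arbitrary initial gradient shifts $h_1^0,\dots,h_n^0\in\mathbb{R}^d$, and a stepsize $\gamma>0$ satisfying $$\gamma\le\min\left\{\frac{n}{160\,\omega L_{\max}},\ \frac{\alpha}{100L},\ \frac{1}{(\omega+1)\mu}\right\}.$$ Then for every number of iterations $T$ the output $x^T$ satisfies $$\frac{1}{2\gamma}\mathrm{E}\left[\|x^T-x^*\|^2\right]+\mathrm{E}\left[f(x^T)-f(x^* )\right]\le\left(1-\frac{\gamma\mu}{2}\right)^T V^0,$$ where $$V^0:=\frac{1}{2\gamma}\mathrm{E}\left[\|x^0-x^*\|^2\right]+\left(f(x^0)-f(x^* )\right)+\frac{8\gamma\omega(\omega+1)}{n^2}\sum_{i=1}^n\|h_i^0-\nabla f_i(x^* )\|^2 .$$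
   Context: $\|\cdot\|$ is the Euclidean norm. A function is $L$-smooth if it is differentiable with $\|\nabla f(x)-\nabla f(y)\|\le L\|x-y\|$ for all $x,y$; the constants $L$ and $L_i$ denote the smallest such numbers. Fractions with zero denominator in upper bounds on the stepsize are read as $+\infty$. Compressors. For $\alpha\in(0,1]$, $\mathbb{B}(\alpha)$ is the set of (possibly) stochastic mappings $\mathcal{C}:\mathbb{R}^d\to\mathbb{R}^d$ with $\mathrm{E}[\|\mathcal{C}(x)-x\|^2]\le(1-\alpha)\|x\|^2$ for all $x\in\mathbb{R}^d$. For $\omega\ge0$, $\mathbb{U}(\omega)$ is the set of stochastic mappings $\mathcal{C}:\mathbb{R}^d\to\mathbb{R}^d$ with $\mathrm{E}[\mathcal{C}(x)]=x$ and $\mathrm{E}[\|\mathcal{C}(x)-x\|^2]\le\omega\|x\|^2$ for all $x\in\mathbb{R}^d$. Algorithm EF21-P + DIANA. Parameters: $\gamma>0$, $\beta$, $x^0\in\mathbb{R}^d$, $w^0=x^0$, shifts $h_1^0,\dots,h_n^0\in\mathbb{R}^d$, $h^0=\frac1n\sum_i h_i^0$. For $t=0,1,\dots,T-1$: $m_i^t=\mathcal{C}_i^D(\nabla f_i(w^t)-h_i^t)$ and $h_i^{t+1}=h_i^t+\beta m_i^t$ for $i=1,\dots,n$; $m^t=\frac1n\sum_i m_i^t$; $g^t=h^t+m^t$; $h^{t+1}=h^t+\beta m^t$; $x^{t+1}=x^t-\gamma g^t$; $w^{t+1}=w^t+\mathcal{C}^P(x^{t+1}-w^t)$. The random draws of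 $\mathcal{C}_1^D,\dots,\mathcal{C}_n^D,\mathcal{C}^P$ are mutually independent and fresh (independent of the past) at every iteration. *)

(* Defs.v *)
From HB Require Import structures.
From mathcomp Require Import all_boot all_order all_algebra finmap.
From mathcomp Require Import all_classical all_reals all_analysis.

Set Implicit Arguments.
Unset Strict Implicit.
Unset Printing Implicit Defensive.

Import Order.TTheory GRing.Theory Num.Theory.
Import numFieldNormedType.Exports.

Local Open Scope classical_set_scope.
Local Open Scope ring_scope.

(** The library norm on ['rV[R]_d] is the sup norm, so the Euclidean norm is
    introduced separately. *)
Definition enorm (R : realType) (d : nat) (v : 'rV[R]_d) : R :=
  Num.sqrt (\sum_(j < d) v 0 j ^+ 2).

Definition gradient (R : realType) (d : nat) (f : 'rV[R]_d -> R)
    (x : 'rV[R]_d) : 'rV[R]_d :=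
  \row_(j < d) 'D_(delta_mx 0 j) f x.

Definition smooth (R : realType) (d : nat) (L : R) (f : 'rV[R]_d -> R) : Prop :=
  (forall x, differentiable f x) /\
  (forall x y, enorm (gradient f x - gradient f y) <= L * enorm (x - y)).

(** [L] is the smallest (nonnegative) Lipschitz constant of the gradient;
    nonnegativity is automatic as soon as [d > 0]. *)
Definition smoothness_constant (R : realType) (d : nat) (L : R)
    (f : 'rV[R]_d -> R) : Prop :=
  [/\ 0 <= L, smooth L f & forall M, 0 <= M -> smooth M f -> L <= M].

Definition strongly_convex (R : realType) (d : nat) (mu : R)
    (f : 'rV[R]_d -> R) : Prop :=
  forall (x y : 'rV[R]_d) (t : R), 0 <= t <= 1 ->
    f (t *: x + (1 - t) *: y) <=
      t * f x + (1 - t) * f y - mu / 2 * t * (1 - t) * enorm (x - y) ^+ 2.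

Definition average (R : realType) (n : nat) (V : lmodType R) (v : 'I_n -> V) : V :=
  n%:R^-1 *: \sum_(i < n) v i.

(** A quotient used as an upper bound: [a / 0] is read as [+oo]. *)
Definition bound_quotient (R : realType) (a b : R) : \bar R :=
  if b == 0 then +oo%E else (a / b)%:E.

(** The Borel sigma-algebra of [R^d], presented as the sigma-algebra generated
    by the coordinate projections. *)
Definition row_coord (R : realType) (d : nat) (j : 'I_d) (v : 'rV[R]_d) : R :=
  v 0 j.

HB.instance Definition _ (R : realType) (d : nat) :=
  @isMeasurable.Build
    (sigma_display (g_sigma_preimage (@row_coord R d))) 'rV[R]_d
    (g_sigma_preimage (@row_coord R d))
    (@sigma_algebra0 _ _ _) (@sigma_algebraC _ _) (@sigma_algebra_bigcup _ _ _).

(** A stochastic mapping [R^d -> R^d]: one evaluation at [v] draws a seed [s]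
    with law [seed_law] and returns [stoch_fun v s]. *)
Record stochastic_map (R : realType) (d : nat) := StochasticMap {
  seed_display : measure_display ;
  seed : measurableType seed_display ;
  seed_law : probability seed R ;
  stoch_fun :> 'rV[R]_d -> seed -> 'rV[R]_d ;
  stoch_measurable :
    measurable_fun [set: 'rV[R]_d * seed] (fun p => stoch_fun p.1 p.2)
}.

Definition contractive_compressor (R : realType) (d : nat) (alpha : R) :
    stochastic_map R d -> Prop :=
  fun C => forall x : 'rV[R]_d,
    ('E_(seed_law C)[fun s => (enorm (C x s - x) ^+ 2)%R]
       <= ((1 - alpha) * enorm x ^+ 2)%:E)%E.

Definition unbiased_compressor (R : realType) (d : nat) (omega : R) :
    stochastic_map R d -> Prop :=
  fun C => forall x : 'rV[R]_d,
    (forall j : 'I_d, 'E_(seed_law C)[fun s => (C x s 0 j)%R] = (x 0 j)%:E)%E /\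
    ('E_(seed_law C)[fun s => (enorm (C x s - x) ^+ 2)%R]
       <= (omega * enorm x ^+ 2)%:E)%E.

Definition mutually_independent (disp : measure_display) (T : measurableType disp)
    (R : realType) (P : probability T R) (I : choiceType)
    (F : I -> set (set T)) : Prop :=
  forall (J : {fset I}) (A : I -> set T),
    (forall i, i \in J -> F i (A i)) ->
    P (\bigcap_(i in [set` J]) A i) = (\prod_(i <- J) P (A i))%E.

(** [(t, Some i)] indexes the draw of worker [i] at iteration [t], and
    [(t, None)] the draw of the server at iteration [t]. *)
Definition draw_sigma_algebra (disp : measure_display) (T : measurableType disp)
    (R : realType) (d n : nat)
    (CD : 'I_n -> stochastic_map R d) (CP : stochastic_map R d)
    (xiD : forall (t : nat) (i : 'I_n), T -> seed (CD i))
    (xiP : forall t : nat, T -> seed CP)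
    (k : nat * option 'I_n) : set (set T) :=
  match k.2 with
  | Some i => preimage_set_system [set: T] (xiD k.1 i) measurable
  | None => preimage_set_system [set: T] (xiP k.1) measurable
  end.

(** [xiD t i] and [xiP t] are the seeds consumed at iteration [t] by the [i]-th
    worker and by the server.  They have the prescribed laws, and are mutually
    independent across workers, server and iterations. *)
Definition fresh_draws (disp : measure_display) (T : measurableType disp)
    (R : realType) (P : probability T R) (d n : nat)
    (CD : 'I_n -> stochastic_map R d) (CP : stochastic_map R d)
    (xiD : forall (t : nat) (i : 'I_n), {RV P >-> seed (CD i)})
    (xiP : forall t : nat, {RV P >-> seed CP}) : Prop :=
  [/\ forall t i A, measurable A -> distribution P (xiD t i) A = seed_law (CD i) A,
      forall t A, measurable A -> distribution P (xiP t) A = seed_law CP A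
    & mutually_independent P
        (draw_sigma_algebra (fun t i => xiD t i) (fun t => xiP t))].

Record diana_state (R : realType) (d n : nat) := DianaState {
  iter_x : 'rV[R]_d ;
  iter_w : 'rV[R]_d ;
  iter_h : 'I_n -> 'rV[R]_d ;
  iter_hbar : 'rV[R]_d
}.

Section EF21P_DIANA.
Variables (R : realType) (d n : nat) (f : 'I_n -> 'rV[R]_d -> R).
Variables (gamma beta : R) (x0 : 'rV[R]_d) (h0 : 'I_n -> 'rV[R]_d).

Definition diana_init : diana_state R d n := DianaState x0 x0 h0 (average h0).

Definition diana_step (cD : 'I_n -> 'rV[R]_d -> 'rV[R]_d)
    (cP : 'rV[R]_d -> 'rV[R]_d) (s : diana_state R d n) : diana_state R d n :=
  let: DianaState x w h hbar := s in
  let m := fun i => cD i (gradient (f i) w - h i) in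
  let mbar := average m in
  let g := hbar + mbar in
  let x' := x - gamma *: g in
  DianaState x' (w + cP (x' - w)) (fun i => h i + beta *: m i)
    (hbar + beta *: mbar).

(** The run for fixed realizations [cD t i] and [cP t] of the compressors. *)
Fixpoint diana_run (cD : nat -> 'I_n -> 'rV[R]_d -> 'rV[R]_d)
    (cP : nat -> 'rV[R]_d -> 'rV[R]_d) (t : nat) : diana_state R d n :=
  match t with
  | 0%N => diana_init
  | t'.+1 => diana_step (cD t') (cP t') (diana_run cD cP t')
  end.

Definition diana_x (T : Type)
    (CD : 'I_n -> stochastic_map R d) (CP : stochastic_map R d)
    (xiD : forall (t : nat) (i : 'I_n), T -> seed (CD i))
    (xiP : forall t : nat, T -> seed CP) (t : nat) (z : T) : 'rV[R]_d :=
  iter_x (diana_run (fun s i v => CD i v (xiD s i z))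
                    (fun s v => CP v (xiP s z)) t).

End EF21P_DIANA.

(* Main.v *)
(* The potential of a state [(x, w, h)] is
     |x - x*|^2 / (2 gamma) + f x - f x* + (3 L / alpha) |w - x|^2
       + (8 gamma omega (omega + 1) / n^2) sum_i |h_i - grad f_i x*|^2,
   whose initial value is [V^0] because [w^0 = x^0].  One iteration multiplies
   its expectation by at most [1 - gamma mu / 2].  Conditionally on the past the
   draws are integrated out one at a time.  The server's draw contracts
   [|w - x|^2] by [1 - alpha]; by smoothness of [f] what remains is bounded by a
   quadratic function of the messages [m_1, ..., m_n], and since a message is
   unbiased, replacing a single [m_i] by its mean costs at most the curvature
   times [omega |grad f_i w - h_i|^2].  The resulting deterministic inequality
   combines the descent lemma, strong convexity and co-coercivity of the
   gradients of the [f_i]. *)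
From HB Require Import structures.
Require Import Defs.
From mathcomp Require Import all_boot all_order all_algebra finmap.
From mathcomp Require Import all_classical all_reals all_analysis.
From mathcomp Require Import measurable_realfun ring lra.

Set Implicit Arguments.
Unset Strict Implicit.
Unset Printing Implicit Defensive.

Import Order.TTheory GRing.Theory Num.Theory.
Import numFieldNormedType.Exports.

Local Open Scope classical_set_scope.
Local Open Scope ring_scope.

(** * Euclidean geometry and smooth convex functions *)

(** The estimates between iterations compare integrals of nonnegative functions in the extended
    reals, so Tonelli's theorem suffices and the iterates are never shown to be integrable.
    Integrability is checked only for one compressor draw at a fixed argument, where the variance
    bound supplies it. Conditional expectations become independence of one draw from the
    sigma-algebra of the earlier ones.

    Draws are removed in reverse order of use, since the server compresses a vector that depends on
    all messages. [favg] is not quadratic in the messages, so the descent lemma must come before the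
    averaging over workers. The curvature is then the same at every point, and replacing messages
    singly adds up the variances without any covariance.

    Origin of the constants: [beta] makes the shift recursion a convex combination; 3 L / alpha
    yields -3/2 L |w-x|^2 against losses slightly above L |w-x|^2; the 8 makes the shift term drop
    by 8 units of gamma omega / n^2 times its sum, of which at most 4 pay for the rate and 1.08 for
    the variance. *)

Section dot_product.
Context {R : realType} {d : nat}.
Implicit Types (u v w : 'rV[R]_d) (k : R).

Definition dot u v : R := \sum_(j < d) u 0 j * v 0 j.

Lemma dotC u v : dot u v = dot v u.
Proof. by apply: eq_bigr => j _; rewrite mulrC. Qed.

Lemma dotDl u v w : dot (u + v) w = dot u w + dot v w.
Proof. by rewrite /dot -big_split; apply: eq_bigr => j _; rewrite mxE mulrDl. Qed.

Lemma dotZl k u v : dot (k *: u) v = k * dot u v.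
Proof. by rewrite /dot mulr_sumr; apply: eq_bigr => j _; rewrite mxE mulrA. Qed.

Lemma dotNl u v : dot (- u) v = - dot u v.
Proof. by rewrite -scaleN1r dotZl mulN1r. Qed.

Lemma dotBl u v w : dot (u - v) w = dot u w - dot v w.
Proof. by rewrite dotDl dotNl. Qed.

Lemma dotDr u v w : dot u (v + w) = dot u v + dot u w.
Proof. by rewrite dotC dotDl 2!(dotC u). Qed.

Lemma dotZr k u v : dot u (k *: v) = k * dot u v.
Proof. by rewrite dotC dotZl dotC. Qed.

Lemma dotNr u v : dot u (- v) = - dot u v.
Proof. by rewrite dotC dotNl dotC. Qed.

Lemma dotBr u v w : dot u (v - w) = dot u v - dot u w.
Proof. by rewrite dotDr dotNr. Qed.

Definition dotE := (dotDl, dotBl, dotNl, dotZl, dotDr, dotBr, dotNr, dotZr).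

Lemma dot0l v : dot 0 v = 0.
Proof. by rewrite -(scale0r 0) dotZl mul0r. Qed.

Lemma dot_ge0 u : 0 <= dot u u.
Proof. by apply: sumr_ge0 => j _; rewrite -expr2 sqr_ge0. Qed.

Lemma dot_eq0 u : dot u u = 0 -> u = 0.
Proof.
move=> /eqP; rewrite psumr_eq0 => [/allP u0|j _]; last by rewrite -expr2 sqr_ge0.
apply/rowP => j; rewrite mxE; apply/eqP.
by have := u0 j (mem_index_enum j); rewrite /= mulf_eq0 orbb.
Qed.

Lemma sqr_enorm u : enorm u ^+ 2 = dot u u.
Proof.
rewrite /enorm sqr_sqrtr; last by apply: sumr_ge0 => j _; rewrite sqr_ge0.
by apply: eq_bigr => j _; rewrite expr2.
Qed.

Lemma enorm_ge0 u : 0 <= enorm u.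
Proof. exact: sqrtr_ge0. Qed.

(** Cauchy-Schwarz: the square of [dot v v *: u - dot u v *: v] is [dot v v] times the difference of
    the two sides. *)
Lemma sqr_dot_le u v : dot u v ^+ 2 <= dot u u * dot v v.
Proof.
have [v0|vN0] := eqVneq (dot v v) 0.
  by rewrite (dot_eq0 v0) dotC !dot0l mulr0 expr0n.
have v_gt0 : 0 < dot v v by rewrite lt_neqAle eq_sym vN0 dot_ge0.
have := dot_ge0 (dot v v *: u - dot u v *: v).
rewrite !dotE (dotC v u) => ge0.
rewrite -subr_ge0 -(pmulr_rge0 _ v_gt0).
by move: ge0; congr (0 <= _); ring.
Qed.

Lemma dot_le_enorm u v : dot u v <= enorm u * enorm v.
Proof.
apply: le_trans (ler_norm _) _; rewrite -ler_sqr ?nnegrE ?mulr_ge0 ?enorm_ge0//.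
by rewrite exprMn !sqr_enorm -normrX ger0_norm ?sqr_ge0// sqr_dot_le.
Qed.

Lemma dot_subC u v : dot (u - v) (u - v) = dot (v - u) (v - u).
Proof. by rewrite -opprB dotNl dotNr opprK. Qed.

Lemma dot_sub_le u v :
  dot (u - v) (u - v) <= 2 * dot u u + 2 * dot v v.
Proof. by have := dot_ge0 (u + v); rewrite !dotE (dotC v u); lra. Qed.

Lemma dot_subZE k u v : dot (u - k *: v) (u - k *: v) =
  dot u u - 2 * k * dot v u + k ^+ 2 * dot v v.
Proof. by rewrite !dotE (dotC u v); ring. Qed.

Lemma dot_subE u v :
  dot (u - v) (u - v) = dot u u + dot v v - 2 * dot v u.
Proof. by have := dot_subZE 1 u v; rewrite scale1r => ->; ring. Qed.

Lemma dot_young k l u v :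
  0 <= k ^+ 2 * dot u u - 2 * k * l * dot u v + l ^+ 2 * dot v v.
Proof.
have := dot_ge0 (k *: u - l *: v); rewrite dot_subZE !dotE (dotC v u).
by congr (_ <= _); ring.
Qed.

(** With k = [beta], [u] a shift and [v] a local gradient, this governs the motion of the shifts;
    the term in k - k^2 is what the variance of the message will fill. *)
Lemma dot_interpolation k u v w :
  dot (u + k *: (v - u) - w) (u + k *: (v - u) - w) +
    (k - k ^+ 2) * dot (v - u) (v - u) =
  (1 - k) * dot (u - w) (u - w) + k * dot (v - w) (v - w).
Proof.
by rewrite !dotE (dotC w u) (dotC w v) (dotC v u); ring.
Qed.

End dot_product.

(** * Inequalities for smooth and strongly convex functions *)

Section calculus.
Context {R : realType} {d : nat}.
Implicit Types (f : 'rV[R]_d -> R) (x y u v w : 'rV[R]_d).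

Lemma derive_gradient f x v : differentiable f x ->
  'D_v f x = dot (gradient f x) v.
Proof.
move=> fx; rewrite deriveE// [v in LHS]row_sum_delta linear_sum /dot.
by apply: eq_bigr => j _; rewrite linearZ /= mxE deriveE// mulrC.
Qed.

Lemma is_derive_line f x v (t : R) : differentiable f (x + t *: v) ->
  is_derive t 1 (fun s : R => f (x + s *: v)) (dot (gradient f (x + t *: v)) v).
Proof.
move=> fx; rewrite -derive_gradient//.
have dv := @diff_derivable _ _ _ _ _ v fx.
have E : (fun h : R => h^-1 *: (f (x + (h *: (1 : R) + t) *: v) - f (x + t *: v)))
    = (fun h : R => h^-1 *: (f (h *: v + (x + t *: v)) - f (x + t *: v))).
  apply/funext => h; congr (_ *: (f _ - _)).
  by rewrite scalerDl /= /GRing.scale /= mulr1 addrCA.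
apply: DeriveDef; last by rewrite /derive /= E.
by rewrite /derivable /= E; exact: dv.
Qed.

Lemma dot_grad_line (L : R) f x v (t : R) : smooth L f -> 0 <= t ->
  dot (gradient f (x + t *: v)) v <= dot (gradient f x) v + t * L * dot v v.
Proof.
move=> [_ fL] t0; rewrite -lerBlDl -dotBl.
apply: le_trans (dot_le_enorm _ _) _.
apply: le_trans (ler_wpM2r (enorm_ge0 _) (fL _ _)) _.
rewrite addrAC subrr add0r.
have -> : enorm (t *: v) = t * enorm v.
  apply: (@pexpIrn _ 2%N); rewrite ?nnegrE ?enorm_ge0 ?mulr_ge0 ?enorm_ge0//.
  by rewrite sqr_enorm exprMn sqr_enorm !dotE mulrA expr2.
by rewrite -(sqr_enorm v) le_eqVlt; apply/orP; left; apply/eqP; ring.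
Qed.

(** Descent lemma without integration: [phi] is [f] along the segment minus the non-constant part of
    the claimed bound, and its derivative is nonpositive on [0, 1] by the Lipschitz property and
    Cauchy-Schwarz. *)
Lemma smooth_le (L : R) f x y : smooth L f ->
  f y <= f x + dot (gradient f x) (y - x) + L / 2 * dot (y - x) (y - x).
Proof.
move=> sf; have [fd fL] := sf; set v := y - x.
pose phi t : R := f (x + t *: v) -
  (t * dot (gradient f x) v + t ^+ 2 * (L / 2 * dot v v)).
have dphi (t : R) : is_derive t (1 : R) phi
    (dot (gradient f (x + t *: v)) v - (dot (gradient f x) v + t * L * dot v v)).
  have d1 := @is_derive_line f x v t (fd _).
  rewrite /phi; apply: is_derive_eq.
  by rewrite /GRing.scale /=; field.
have cphi : continuous phi.
  move=> t; apply: differentiable_continuous; apply/derivable1_diffP.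
  by have [] := dphi t.
have : phi 1 <= phi 0.
  have phi_le := @ler0_derive1_le_cc R phi 0 1.
  apply: phi_le; rewrite ?in_itv /= ?lexx ?ler01//.
  - move=> t; rewrite in_itv /= => /andP[t0 _].
    rewrite derive1E; have [_ ->] := dphi t.
    by rewrite subr_le0 dot_grad_line// ltW.
  - exact: continuous_subspaceT.
have xv : x + v = y by rewrite addrC subrK.
rewrite /phi scale0r scale1r addr0 xv expr1n; lra.
Qed.

(** Divide the defining inequality at t y + (1 - t) x by t and let t tend to 0 from the right: the
    quotients tend to the directional derivative, and the factor 1 - t of the modulus leaves only
    the vanishing term t c. *)
Lemma strongly_convex_ge (mu : R) f x y :
  strongly_convex mu f -> differentiable f x ->
  f x + dot (gradient f x) (y - x) + mu / 2 * dot (y - x) (y - x) <= f y.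
Proof.
move=> fsc fx; set v := y - x.
pose c := mu / 2 * dot v v.
have slope t : 0 < t -> t <= 1 ->
    t^-1 * (f (t *: v + x) - f x) <= f y - f x - c + t * c.
  move=> t0 t1; rewrite ler_pdivrMl//.
  have := fsc y x t; rewrite t1 (ltW t0) => /(_ isT).
  have -> : t *: y + (1 - t) *: x = t *: v + x.
    by apply/rowP => j; rewrite !mxE; ring.
  rewrite sqr_enorm -/v => H.
  have -> : t * (f y - f x - c + t * c) =
      t * f y + (1 - t) * f x - mu / 2 * t * (1 - t) * dot v v - f x.
    by rewrite /c; ring.
  lra.
have dlim := @diff_derivable _ _ _ _ _ v fx.
have /cvg_ex [l dl] := dlim.
have lE : l = dot (gradient f x) v.
  by rewrite -derive_gradient//; apply/esym/cvg_lim.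
rewrite -lerBrDr -/c -lE.
have cr : (fun t : R => t^-1 *: (f (t *: v + x) - f x)) @ 0^'+ --> l.
  exact: cvg_dnbhs_at_right dl.
have cs : (fun t : R => f y - f x - c + t * c) @ 0^'+ --> f y - f x - c + 0 * c.
  apply: cvgD; first exact: cvg_cst.
  by apply: cvgMl; exact: cvg_at_right_filter (@cvg_id _ _).
have : l <= f y - f x - c + 0 * c.
  apply: (ler_cvg_to cr cs).
  near=> t; apply: slope; near: t; [exact: nbhs_right_gt|].
  exact: nbhs_right_le.
rewrite mul0r; lra.
Unshelve. all: by end_near. Qed.

Lemma convex_strongly_convex f :
  convex_function (E := 'rV[R]_d) setT f -> strongly_convex 0 f.
Proof.
move=> cf x y t /andP[t0 t1]; rewrite !mul0r subr0.
exact: (cf (Itv01 t0 t1) x y (in_setT _) (in_setT _)).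
Qed.

(** The best choice is s = 1/L. When L = 0 the hypothesis bounds a linear function of s, which
    forces a = 0; s = (b + 1)/a exhibits the contradiction. *)
Lemma quadratic_le (L a b : R) : 0 <= L -> 0 <= a ->
  (forall s, s * a - L / 2 * s ^+ 2 * a <= b) -> a <= 2 * L * b.
Proof.
move=> L0 a0 key; have [L_eq0|L_neq0] := eqVneq L 0.
  move: a0; rewrite le_eqVlt => /orP[/eqP <-|a_gt0].
    by rewrite L_eq0 mulr0 mul0r.
  have := key ((b + 1) / a).
  rewrite L_eq0 !mul0r subr0 divfK ?gt_eqF//; lra.
have L_gt0 : 0 < L by rewrite lt_neqAle eq_sym L_neq0.
have := key L^-1.
have -> : L^-1 * a - L / 2 * L^-1 ^+ 2 * a = (2 * L)^-1 * a by field.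
by rewrite ler_pdivrMl// mulr_gt0.
Qed.

(** Co-coercivity: at x - s u, with [u] the difference of the gradients, compare the descent bound
    from [x] with the tangent at [y], then optimize over s. *)
Lemma smooth_bregman_ge (L : R) f x y : 0 <= L -> smooth L f ->
  strongly_convex 0 f ->
  dot (gradient f x - gradient f y) (gradient f x - gradient f y) <=
    2 * L * (f x - f y - dot (gradient f y) (x - y)).
Proof.
move=> L0 sf cf; have [fd _] := sf.
have [u uE] : exists u, u = gradient f x - gradient f y.
  by exists (gradient f x - gradient f y).
rewrite -uE; apply: quadratic_le => [//||s]; first exact: dot_ge0.
have := smooth_le x (x - s *: u) sf.
have := strongly_convex_ge (x - s *: u) cf (fd y).
rewrite !mul0r addr0.
have -> : x - s *: u - x = - s *: u by rewrite addrAC subrr add0r scaleNr.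
rewrite !dotE.
have -> : dot (gradient f x) u = dot u u + dot (gradient f y) u.
  by rewrite {2}uE dotBl subrK.
lra.
Qed.

Lemma smooth_grad_le (L : R) f x y : 0 <= L -> smooth L f ->
  (forall z, f y <= f z) ->
  dot (gradient f x) (gradient f x) <= 2 * L * (f x - f y).
Proof.
move=> L0 sf fmin; set u := gradient f x.
apply: quadratic_le => [//||s]; first exact: dot_ge0.
have := smooth_le x (x - s *: u) sf.
have := fmin (x - s *: u).
have -> : x - s *: u - x = - s *: u by rewrite addrAC subrr add0r scaleNr.
rewrite !dotE -/u; lra.
Qed.

Lemma smooth_step_le (L k : R) f x v : smooth L f ->
  f (x - k *: v) <=
    f x - k * dot (gradient f x) v + L * k ^+ 2 / 2 * dot v v.
Proof.
move=> sf; have := smooth_le x (x - k *: v) sf.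
have -> : x - k *: v - x = - k *: v by rewrite addrAC subrr add0r scaleNr.
rewrite !dotE; lra.
Qed.

Lemma bregman_ge0 f x y : strongly_convex 0 f -> differentiable f y ->
  0 <= f x - f y - dot (gradient f y) (x - y).
Proof.
by move=> cf fy; have := strongly_convex_ge x cf fy; rewrite !mul0r; lra.
Qed.

(** The algorithm uses the gradient at [w] while progress is measured at [x]. Smoothness from [w] to
    [x] and strong convexity from [w] to [z] share the gradient at [w], so their sum leaves only its
    product with x - z. *)
Lemma grad_dot_ge (L mu : R) f x w z : smooth L f -> strongly_convex mu f ->
  f x - f z - L / 2 * dot (w - x) (w - x) + mu / 2 * dot (w - z) (w - z) <=
    dot (gradient f w) (x - z).
Proof.
move=> sf cf; have [fd _] := sf.
have := smooth_le w x sf; have := strongly_convex_ge z cf (fd w).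
rewrite (dot_subC x) (dot_subC z) !dotBr; lra.
Qed.

(** Stands in for mu <= L, which may fail when d = 0; the factor keeps it true there. *)
Lemma strongly_convex_smooth_le (L mu : R) f x y :
  smooth L f -> strongly_convex mu f ->
  mu * dot (y - x) (y - x) <= L * dot (y - x) (y - x).
Proof.
move=> sf cf; have [fd _] := sf.
have := smooth_le x y sf; have := strongly_convex_ge y cf (fd x); lra.
Qed.

Lemma smooth_grad_dist (L : R) f x y : smooth L f ->
  dot (gradient f x - gradient f y) (gradient f x - gradient f y) <=
    L ^+ 2 * dot (x - y) (x - y).
Proof.
move=> [_ fL]; rewrite -!sqr_enorm -exprMn ler_sqr ?nnegrE ?enorm_ge0//.
by apply: le_trans (fL x y); exact: enorm_ge0.
Qed.

Lemma smooth_gap_le (L : R) f x w z : 0 <= L -> smooth L f ->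
  (forall y, f z <= f y) ->
  f w - f z <= 2 * (f x - f z) + L * dot (w - x) (w - x).
Proof.
move=> L0 sf fmin; have := smooth_le x w sf; have := smooth_grad_le x L0 sf fmin.
have := sqr_dot_le (gradient f x) (w - x).
set q := dot _ (w - x); set Q := dot (gradient f x) _; set E := dot (w - x) _.
have F0 : 0 <= f x - f z by rewrite subr_ge0.
have E0 : 0 <= E := dot_ge0 _.
have LE0 : 0 <= L * E by rewrite mulr_ge0.
move=> qQE hQ hw; suff : q <= f x - f z + L * E / 2 by lra.
apply: le_trans (ler_norm _) _.
rewrite -ler_sqr ?nnegrE//; last by rewrite addr_ge0 ?divr_ge0.
rewrite real_normK ?num_real//.
apply: le_trans qQE _; apply: le_trans (ler_wpM2r E0 hQ) _.
(* With F = f x - f z, this is 2 L F E <= (F + L E / 2)^2, whose defect is (F - L E / 2)^2. *)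
have := sqr_ge0 (f x - f z - L * E / 2); clear; lra.
Qed.

Lemma grad_min_eq0 (L : R) f y : 0 <= L -> smooth L f ->
  (forall z, f y <= f z) -> gradient f y = 0.
Proof.
move=> L0 sf fmin; apply/dot_eq0/le_anti; rewrite dot_ge0 andbT.
by have := smooth_grad_le y L0 sf fmin; rewrite subrr mulr0.
Qed.

End calculus.

(** * The one-step inequality *)

Section one_step_inequality.
Context {R : realType}.

(** Young's inequality with weight alpha/2 on the cross term, the last hypothesis being |alpha e - 2
    gamma p|^2 >= 0 for e = w - x and p the gradient at [w]. Then (1 - alpha)(1 + alpha/2) <= 1 -
    alpha/2 and (1 - alpha)(1 + 2/alpha) <= 2/alpha: half of the contraction survives. *)
Lemma server_error_bound (alpha gamma E EP PP : R) : 0 < alpha <= 1 ->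
  0 <= E -> 0 <= PP ->
  0 <= alpha ^+ 2 * E - 4 * alpha * gamma * EP + 4 * gamma ^+ 2 * PP ->
  (1 - alpha) * (E + 2 * gamma * EP + gamma ^+ 2 * PP) <=
    (1 - alpha / 2) * E + 2 / alpha * gamma ^+ 2 * PP.
Proof.
move=> /andP[a0 a1] E0 PP0 young.
have cross : 2 * gamma * EP <= alpha / 2 * E + 2 / alpha * gamma ^+ 2 * PP.
  rewrite -(ler_pM2l (x := 2 * alpha)) ?mulr_gt0//.
  have -> : 2 * alpha * (alpha / 2 * E + 2 / alpha * gamma ^+ 2 * PP) =
    alpha ^+ 2 * E + 4 * gamma ^+ 2 * PP by field; rewrite gt_eqF.
  lra.
have gP : 0 <= gamma ^+ 2 * PP by rewrite mulr_ge0// sqr_ge0.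
have : (1 - alpha) * (E + 2 * gamma * EP + gamma ^+ 2 * PP) <=
    (1 - alpha) * (E + (alpha / 2 * E + 2 / alpha * gamma ^+ 2 * PP) +
      gamma ^+ 2 * PP).
  by apply: ler_wpM2l; [lra|rewrite lerD2r lerD2l].
move=> /le_trans; apply.
have -> : (1 - alpha) * (E + (alpha / 2 * E + 2 / alpha * gamma ^+ 2 * PP) +
      gamma ^+ 2 * PP) = (1 - alpha / 2) * E + 2 / alpha * gamma ^+ 2 * PP
    - (alpha ^+ 2 / 2 * E + (1 + alpha) * (gamma ^+ 2 * PP)).
  by field; rewrite gt_eqF.
rewrite gerBl addr_ge0// mulr_ge0//; [|lra].
by rewrite divr_ge0// sqr_ge0.
Qed.

(* The letters stand for [X = |x-x*|^2], [F = f x - f x*], [E = |w-x|^2],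
   [PP = |grad f w|^2], [QQ = |grad f x|^2], [W = |w-x*|^2],
   [G = sum |grad f_i w - grad f_i x*|^2], [H = sum |h_i - grad f_i x*|^2],
   [D = sum |grad f_i w - h_i|^2], [Fw = f w - f x*], and [PX], [QP], [EP] for
   the inner products of [grad f w] with [x-x*], [grad f x], [w-x]. *)
Lemma one_step_le (gamma L Lm mu omega alpha n X F E PP QQ W G H D Fw PX QP EP : R)
  (kappa := 3 * L / alpha) (nu := 8 * gamma * omega * (omega + 1) / n ^+ 2)
  (beta := (omega + 1)^-1)
  (a := gamma / 2 + L * gamma ^+ 2 / 2 + kappa * (1 - alpha) * gamma ^+ 2) :
  0 < gamma -> 0 <= L -> 0 <= Lm -> 0 <= mu -> 0 <= omega -> 0 < alpha <= 1 ->
  0 < n ->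
  160 * omega * Lm * gamma <= n -> 100 * L * gamma <= alpha ->
  (omega + 1) * mu * gamma <= 1 ->
  0 <= X -> 0 <= F -> 0 <= E -> 0 <= PP -> 0 <= QQ -> 0 <= H -> 0 <= G ->
  F - L / 2 * E + mu / 2 * W <= PX -> X / 2 - E <= W -> mu * E <= L * E ->
  PP + QQ - 2 * QP <= L ^+ 2 * E -> PP <= 2 * QQ + 2 * L ^+ 2 * E ->
  QQ <= 2 * L * F ->
  0 <= alpha ^+ 2 * E - 4 * alpha * gamma * EP + 4 * gamma ^+ 2 * PP ->
  G <= 2 * Lm * n * Fw -> Fw <= 2 * F + L * E -> D <= 2 * G + 2 * H ->
  (2 * gamma)^-1 * (X - 2 * gamma * PX + gamma ^+ 2 * PP) +
  (F - gamma * QP + L * gamma ^+ 2 / 2 * PP) +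
  kappa * ((1 - alpha) * (E + 2 * gamma * EP + gamma ^+ 2 * PP)) +
  nu * ((1 - beta) * H + beta * G) + a / n ^+ 2 * omega * D <=
  (1 - gamma * mu / 2) * ((2 * gamma)^-1 * X + F + kappa * E + nu * H).
Proof.
move=> g0 L0 Lm0 mu0 om0 a01 n0 Lmg Lg mug X0 F0 E0 PP0 QQ0 H0 G0.
move=> hPX hW hmu hQP hPP hQQ hEP hG hFw hD.
have /andP[al0 al1] := a01.
have om1 : omega + 1 != 0 by rewrite gt_eqF// ltr_wpDl.
have := server_error_bound a01 E0 PP0 hEP.
set S := (1 - alpha) * (E + _ + _) => hS.
pose l := L * E; have l0 : 0 <= l by exact: mulr_ge0.
pose rho := L * gamma / alpha.
have rho0 : 0 <= rho by rewrite divr_ge0 ?mulr_ge0// ltW.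
have rho1 : rho <= 100^-1 by rewrite ler_pdivrMr//; clear -Lg; lra.
have rho2 : rho ^+ 2 <= 10000^-1.
  have -> : 10000^-1 = 100^-1 ^+ 2 :> R by field.
  by rewrite ler_pXn2r// ?nnegrE// invr_ge0.
have gL : L * gamma <= 100^-1 by clear -Lg al1; lra.
have gL0 : 0 <= L * gamma by rewrite mulr_ge0// ltW.
have LPP : L * PP <= 4 * L ^+ 2 * F + 2 * L ^+ 2 * l.
  have := ler_wpM2l L0 hPP; have := ler_wpM2l L0 hQQ.
  rewrite /l; clear; lra.
have gLPP : L * gamma ^+ 2 * PP <= 10000^-1 * (4 * F + 2 * l).
  have -> : L * gamma ^+ 2 * PP = gamma ^+ 2 * (L * PP) by ring.
  apply: le_trans (ler_wpM2l (sqr_ge0 _) LPP) _.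
  have -> : gamma ^+ 2 * (4 * L ^+ 2 * F + 2 * L ^+ 2 * l) =
     (L * gamma) ^+ 2 * (4 * F + 2 * l) by ring.
  apply: ler_wpM2r; first by clear -F0 l0; lra.
  have -> : 10000^-1 = 100^-1 ^+ 2 :> R by field.
  by rewrite ler_pXn2r// ?nnegrE// invr_ge0.
(* The gain is kappa alpha / 2 = 3 L / 2 times [E]. It is the only negative multiple of [l] and has
   to absorb all the errors caused by evaluating gradients at [w]. *)
have kS : kappa * S <= kappa * E - 3 / 2 * l + 6 * 10000^-1 * (4 * F + 2 * l).
  have k0 : 0 <= kappa by rewrite divr_ge0 ?mulr_ge0// ltW.
  apply: le_trans (ler_wpM2l k0 hS) _.
  have -> : kappa * ((1 - alpha / 2) * E + 2 / alpha * gamma ^+ 2 * PP) =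
      kappa * E - 3 / 2 * l + 6 * (gamma / alpha) ^+ 2 * (L * PP).
    by rewrite /kappa /l; field; rewrite gt_eqF.
  rewrite lerD2l -[leRHS]mulrA -[leLHS]mulrA ler_wpM2l//.
  apply: le_trans (ler_wpM2l (sqr_ge0 _) LPP) _.
  have -> : (gamma / alpha) ^+ 2 * (4 * L ^+ 2 * F + 2 * L ^+ 2 * l) =
     rho ^+ 2 * (4 * F + 2 * l) by rewrite /rho; field; rewrite gt_eqF.
  by apply: ler_wpM2r => //; clear -F0 l0; lra.
pose r := gamma * omega / n ^+ 2.
have r0 : 0 <= r by rewrite divr_ge0 ?sqr_ge0// mulr_ge0// ltW.
(* The bracket is at most 1/2 + 1/200 + 3/100 = 0.535. *)
have ar : a / n ^+ 2 * omega <= 54 / 100 * r.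
  have -> : a / n ^+ 2 * omega = (1 / 2 + L * gamma / 2 + 3 * rho * (1 - alpha)) * r.
    by rewrite /a /r /kappa /rho; field; rewrite !gt_eqF.
  apply: ler_wpM2r => //.
  have : 0 <= rho * alpha by rewrite mulr_ge0// ltW.
  clear -gL rho1; lra.
have aD : a / n ^+ 2 * omega * D <= 54 / 100 * r * (2 * G + 2 * H).
  have a0 : 0 <= a / n ^+ 2 * omega.
    rewrite mulr_ge0// divr_ge0 ?sqr_ge0// /a !addr_ge0//.
    - by rewrite divr_ge0// ltW.
    - by rewrite divr_ge0// mulr_ge0// sqr_ge0.
    - rewrite mulr_ge0 ?sqr_ge0// mulr_ge0//; [|by rewrite subr_ge0].
      by rewrite divr_ge0 ?mulr_ge0// ltW.
  apply: le_trans (ler_wpM2l a0 hD) _; apply: ler_wpM2r => //.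
  by clear -G0 H0; lra.
have rG : r * G <= 2 / 160 * (2 * F + l).
  apply: le_trans (ler_wpM2l r0 hG) _.
  have -> : r * (2 * Lm * n * Fw) = 2 * (gamma * omega * Lm / n) * Fw.
    by rewrite /r; field; rewrite gt_eqF.
  have c0 : 0 <= gamma * omega * Lm / n.
    by rewrite divr_ge0 ?mulr_ge0// ltW.
  have c1 : gamma * omega * Lm / n <= 160^-1.
    by rewrite ler_pdivrMr//; clear -Lmg; lra.
  apply: (@le_trans _ _ (2 * (gamma * omega * Lm / n) * (2 * F + l))).
    by apply: ler_wpM2l => //; rewrite mulr_ge0.
  by apply: ler_wpM2r; [clear -F0 l0|clear -c1]; lra.
have -> : (2 * gamma)^-1 * (X - 2 * gamma * PX + gamma ^+ 2 * PP) =
   (2 * gamma)^-1 * X - PX + gamma / 2 * PP by field; rewrite gt_eqF.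
(* The factor omega + 1 in [nu] cancels [beta], so the shifts are damped in the same unit [r] in
   which the compression variance is measured. *)
have -> : nu * ((1 - beta) * H + beta * G) = nu * H - 8 * (r * H) + 8 * (r * G).
  by rewrite /nu /beta /r; field; rewrite om1 gt_eqF.
have -> : (1 - gamma * mu / 2) * ((2 * gamma)^-1 * X + F + kappa * E + nu * H) =
  (2 * gamma)^-1 * X - mu / 4 * X + (1 - gamma * mu / 2) * F + kappa * E
   - kappa / 2 * gamma * (mu * E) + nu * H - 4 * ((omega + 1) * mu * gamma) * (r * H).
  by rewrite /nu /r; field; rewrite !gt_eqF.
have gmu : 0 <= gamma * mu by rewrite mulr_ge0// ltW.
have gmu1 : gamma * mu <= 1.
  apply: le_trans mug; rewrite -mulrA [mu * _]mulrC ler_peMl//; clear -om0; lra.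
have hF : F / 2 <= (1 - gamma * mu / 2) * F.
  by rewrite mulrC; apply: ler_wpM2r => //; clear -gmu1; lra.
have hk : kappa / 2 * gamma * (mu * E) <= 3 / 200 * l.
  have -> : kappa / 2 * gamma * (mu * E) = 3 / 2 * rho * (mu * E).
    by rewrite /kappa /rho; field; rewrite gt_eqF.
  by apply: ler_pM; [clear -rho0; lra|rewrite mulr_ge0|clear -rho1; lra|].
have rH0 : 0 <= r * H by rewrite mulr_ge0.
have hH : 4 * ((omega + 1) * mu * gamma) * (r * H) <= 4 * (r * H).
  by apply: ler_wpM2r => //; clear -mug; lra.
(* With p and q the gradients at [w] and [x], the left side is gamma / 2 times |p - q|^2 - |q|^2;
   the term in q is dropped. *)
have hQ : gamma / 2 * PP - gamma * QP <= L * gamma / 2 * l.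
  have -> : L * gamma / 2 * l = gamma / 2 * (L ^+ 2 * E) by rewrite /l; ring.
  have -> : gamma / 2 * PP - gamma * QP = gamma / 2 * (PP - 2 * QP) by field.
  by apply: ler_wpM2l; [rewrite divr_ge0// ltW | clear -hQP QQ0; lra].
have hLl : L * gamma / 2 * l <= 200^-1 * l.
  by apply: ler_wpM2r => //; clear -gL; lra.
(* Strong convexity was gained at [w]; transferring it to [x] costs mu E / 2 <= l / 2. *)
have hX : F - l / 2 + mu / 4 * X - l / 2 <= PX.
  have := ler_wpM2l mu0 hW; rewrite /l; clear -hPX hmu; lra.
clear -kS aD rG hF hk hH hQ hLl hX gLPP F0 l0 rH0.
(* The balance, with 9.08 = 8 + 2 * 0.54 the total coefficient of [r * G]: [F] needs about 9.08 *
   4/160 < 1/2; [l] gets 1 + 9.08 * 2/160 plus small terms, below 3/2; [r * H] gets -8 + 1.08 + 4 <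
   0. *)
lra.
Qed.

End one_step_inequality.

(** * Freezing the past *)

Section independence_of_the_past.
Context {disp : measure_display} {T : measurableType disp} {R : realType}.
Variables (P : probability T R) (I : choiceType) (F : I -> set (set T)).
Hypotheses (F_measurable : forall i, F i `<=` measurable)
  (F_setT : forall i, F i setT) (F_setI : forall i, setI_closed (F i))
  (F_indep : mutually_independent P F).

Definition past (K : set I) : set (set T) := \bigcup_(i in K) F i.

(** The pi-system generating the past: [past K] need not be stable under intersections of events
    with different indices. *)
Definition cylinder (K : set I) : set (set T) :=
  [set A | exists2 J : {fset I}, [set` J] `<=` K & exists2 E : I -> set T,
    forall i, i \in J -> F i (E i) & A = \bigcap_(i in [set` J]) E i].

Lemma past_measurable (K : set I) : past K `<=` measurable.
Proof. by move=> A [i _]; exact: F_measurable. Qed.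

Lemma sigma_past_measurable (K : set I) : <<s past K >> `<=` measurable.
Proof.
by apply: smallest_sub (@past_measurable K); exact: sigma_algebra_measurable.
Qed.

Lemma past_cylinder (K : set I) : past K `<=` cylinder K.
Proof.
move=> A [i Ki FA]; exists [fset i]%fset.
  by move=> j /=; rewrite inE => /eqP ->.
exists (fun=> A); first by move=> j; rewrite inE => /eqP ->.
by rewrite set_fset1 bigcap_set1.
Qed.

Lemma cylinder_measurable (K : set I) : cylinder K `<=` measurable.
Proof.
move=> _ [J _ [E FE ->]]; apply: fin_bigcap_measurable => //.
by move=> i /= iJ; exact/F_measurable/FE.
Qed.

Lemma cylinder_setI (K : set I) : setI_closed (cylinder K).
Proof.
move=> _ _ [J1 J1K [E1 FE1 ->]] [J2 J2K [E2 FE2 ->]].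
exists (J1 `|` J2)%fset.
  by move=> i /=; rewrite inE => /orP[/J1K|/J2K].
exists (fun i => (if i \in J1 then E1 i else setT) `&`
                 (if i \in J2 then E2 i else setT)).
  move=> i _; apply: F_setI; case: ifPn => // iJ; [exact: FE1|exact: FE2].
apply/seteqP; split=> z.
  by move=> [z1 z2] i _ /=; split; case: ifPn => // iJ; [exact: z1|exact: z2].
move=> zE; split=> i iJ; have := zE i; rewrite /= inE.
  by rewrite (_ : i \in J1)// => /(_ isT)[].
by rewrite (_ : i \in J2)// orbT => /(_ isT)[].
Qed.

(** As functions of [A], both sides are finite measures; they agree on the cylinders by mutual
    independence, hence on the sigma-algebra these generate. *)
Lemma past_indep (K : set I) (k : I) (A B : set T) : ~ K k ->
  <<s past K >> A -> F k B -> (P (A `&` B) = P A * P B)%E.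
Proof.
move=> Kk sA FB; have mB := F_measurable FB.
have PB0 : 0 <= fine (P B) by rewrite fine_ge0// measure_ge0.
have PBE : (fine (P B))%:E = P B by rewrite fineK// fin_num_measure.
pose m1 : {measure set T -> \bar R} := mrestr P mB.
pose m2 : {measure set T -> \bar R} := mscale (NngNum PB0) P.
rewrite muleC -PBE; change (m1 A = m2 A).
apply: (g_sigma_algebra_measure_unique (cylinder K) _ (fun=> setT)).
- exact: cylinder_measurable.
- move=> _; exists fset0; first by move=> i /=; rewrite inE.
  by exists (fun=> setT) => //; rewrite set_fset0 bigcap_set0.
- by rewrite bigcup_const//; exists 0%N.
- exact: cylinder_setI.
- move=> _ [J JK [E FE ->]].
  rewrite /m1 /m2 /= /mrestr /mscale /= PBE.
  have kJ : k \notin J by apply/negP => /JK.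
  (* Since [k] is not in [J], intersecting the cylinder with [B] gives a cylinder over one more
     index, to which mutual independence applies. *)
  pose E' i := if i == k then B else E i.
  have EE' i : i \in J -> E' i = E i.
    by move=> iJ; rewrite /E'; case: eqP => // ik; rewrite ik (negPf kJ) in iJ.
  have -> : \bigcap_(i in [set` J]) E i `&` B =
      \bigcap_(i in [set` (k |` J)%fset]) E' i.
    apply/seteqP; split=> z.
      move=> [zE zB] i /=; rewrite !inE => /orP[/eqP ->|iJ].
        by rewrite /E' eqxx.
      by rewrite EE'//; exact: zE.
    move=> zE; split.
      by move=> i /= iJ; rewrite -EE'//; apply: zE => /=; rewrite !inE iJ orbT.
    by have := zE k; rewrite /E' eqxx; apply; rewrite /= !inE eqxx.
  rewrite F_indep; last first.
    move=> i; rewrite !inE => /orP[/eqP ->|iJ]; first by rewrite /E' eqxx.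
    by rewrite EE'//; exact: FE.
  rewrite big_fsetU1//= F_indep// {1}/E' eqxx; congr (_ * _)%E.
  by apply: eq_big_seq => i iJ; rewrite EE'.
- move=> _; rewrite /m1 /= /mrestr setTI.
  by rewrite ltey_eq fin_num_measure.
- exact: sub_smallest2r (@past_cylinder K) _ sA.
Qed.

End independence_of_the_past.

(** * Integrating out one independent draw *)

Section freezing.
Local Open Scope ereal_scope.
Context {disp dX dS : measure_display} {T : measurableType disp}
  {TX : measurableType dX} {S : measurableType dS} {R : realType}.
Variables (P : probability T R) (nu : probability S R).
Variables (X : {RV P >-> TX}) (Y : {RV P >-> S}).
Hypotheses (Y_law : forall B, measurable B -> distribution P Y B = nu B)
  (XY_indep : forall A B, measurable A -> measurable B ->
     P (X @^-1` A `&` Y @^-1` B) = P (X @^-1` A) * P (Y @^-1` B)).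

(** Independence on rectangles identifies the joint law of [X] and [Y] with the product measure;
    Tonelli then integrates over the second factor first. *)
Lemma ge0_integral_freeze (g : TX * S -> \bar R) :
  measurable_fun [set: TX * S] g -> (forall p, 0 <= g p) ->
  \int[P]_z g (X z, Y z) = \int[P]_z \int[nu]_s g (X z, s).
Proof.
move=> mg g0.
have mXY : measurable_fun [set: T] (fun z => (X z, Y z)).
  exact: measurable_fun_pair.
pose XY : {mfun T >-> (TX * S)%type} :=
  HB.pack (fun z => (X z, Y z)) (isMeasurableFun.Build _ _ _ _ _ mXY).
transitivity (\int[distribution P XY]_p g p).
  by rewrite ge0_integral_distribution.
transitivity (\int[distribution P X \x nu]_p g p).
  apply: eq_measure_integral => A mA _; apply/esym.
  apply: (@product_measure_unique _ _ _ _ _ (distribution P X) nu) => //.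
  move=> A1 A2 mA1 mA2; apply: eq_trans (XY_indep mA1 mA2) _.
  by congr (_ * _); exact: Y_law.
rewrite fubini_tonelli1// ge0_integral_distribution//.
- exact: measurable_fun_fubini_tonelli_F.
- by move=> z; exact: integral_ge0.
Qed.

Lemma ge0_le_integral_freeze (g : TX * S -> \bar R) (h : TX -> \bar R) :
  measurable_fun [set: TX * S] g -> (forall p, 0 <= g p) ->
  measurable_fun [set: TX] h -> (forall x, \int[nu]_s g (x, s) <= h x) ->
  \int[P]_z g (X z, Y z) <= \int[P]_z h (X z).
Proof.
move=> mg g0 mh gh; rewrite ge0_integral_freeze//.
apply: ge0_le_integral => //.
- by move=> z _; exact: integral_ge0.
- have mF : measurable_fun [set: TX] (fun x => \int[nu]_s g (x, s)).
    exact: measurable_fun_fubini_tonelli_F.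
  exact: (measurableT_comp mF).
- exact: (measurableT_comp mh).
Qed.

End freezing.

(** * Measurability on row vectors *)

Section measurable_row_vectors.
Context {R : realType} {d : nat}.

Lemma measurable_row_coord (j : 'I_d) :
  measurable_fun [set: 'rV[R]_d] (row_coord j).
Proof.
move=> _ A mA; apply: sub_sigma_algebra; rewrite -bigcup_seq/=.
by exists j; [rewrite /= mem_index_enum|exists A].
Qed.

Context {dT : measure_display} {T : measurableType dT}.
Implicit Types (X Y : T -> 'rV[R]_d).

Lemma measurable_fun_rowP X : measurable_fun setT X <->
  forall j, measurable_fun setT (fun z => X z 0 j).
Proof.
split=> [mX j|mX].
  exact: (measurableT_comp (measurable_row_coord j) mX).
have measE : @measurable _ 'rV[R]_d = <<s \big[setU/set0]_(i < d)
  preimage_set_system setT (@row_coord R d i) measurable >> by [].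
apply: (measurability _ measE) => _ [B + <-].
rewrite -bigcup_seq/= => -[j _ [A mA <-]].
by rewrite !setTI -comp_preimage -[_ @^-1` _]setTI; exact: mX.
Qed.

Lemma measurable_rowD X Y : measurable_fun setT X -> measurable_fun setT Y ->
  measurable_fun setT (fun z => X z + Y z).
Proof.
move=> /measurable_fun_rowP mX /measurable_fun_rowP mY.
apply/measurable_fun_rowP => j; under eq_fun do rewrite mxE.
exact: measurable_funD.
Qed.

Lemma measurable_rowZ k X : measurable_fun setT X ->
  measurable_fun setT (fun z => k *: X z).
Proof.
move=> /measurable_fun_rowP mX.
apply/measurable_fun_rowP => j; under eq_fun do rewrite mxE.
exact: measurable_funM.
Qed.

Lemma measurable_rowB X Y : measurable_fun setT X -> measurable_fun setT Y ->
  measurable_fun setT (fun z => X z - Y z).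
Proof.
move=> mX mY; under eq_fun do rewrite -scaleN1r.
by apply: measurable_rowD => //; exact: measurable_rowZ.
Qed.

Lemma measurable_average n (X : 'I_n -> T -> 'rV[R]_d) :
  (forall i, measurable_fun setT (X i)) ->
  measurable_fun setT (fun z => average (fun i => X i z)).
Proof.
move=> mX; apply/measurable_rowZ/measurable_fun_rowP => j.
under eq_fun do rewrite summxE.
by apply: measurable_sum => i; have /measurable_fun_rowP := mX i.
Qed.

Lemma measurable_dot X Y : measurable_fun setT X -> measurable_fun setT Y ->
  measurable_fun setT (fun z => dot (X z) (Y z)).
Proof.
move=> /measurable_fun_rowP mX /measurable_fun_rowP mY.
by apply: measurable_sum => j; exact: measurable_funM.
Qed.

End measurable_row_vectors.

(** * Open sets, continuous functions and gradients *)

Section continuous_row_vectors.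
Context {R : realType} {d : nat}.

(* Sup-norm balls with rational centre and radius [1/(m+1)] form a countable
   basis of measurable boxes. *)
Lemma open_row_measurable (U : set 'rV[R]_d) : open U -> measurable U.
Proof.
move=> oU.
pose box (p : 'rV[rat]_d * nat) : set 'rV[R]_d :=
  ball (map_mx ratr p.1 : 'rV[R]_d) p.2.+1%:R^-1.
have mbox p : measurable (box p).
  have -> : box p = \bigcap_(j in [set: 'I_d]) (row_coord j @^-1`
      ball (ratr (p.1 0 j) : R) p.2.+1%:R^-1).
    apply/seteqP; split=> y.
      by move=> [_ yb] j _; have := yb 0 j; rewrite mxE.
    move=> yb; split=> [|i j]; first by rewrite invr_gt0.
    by rewrite mxE ord1; exact: yb.
  apply: fin_bigcap_measurable => // j _.
  rewrite -[_ @^-1` _]setTI; apply: measurable_row_coord => //.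
  exact: measurable_ball.
suff -> : U = \bigcup_(p in [set p | box p `<=` U]) box p.
  rewrite bigcup_mkcond; apply: countable_bigcupT_measurable => //.
  by move=> p; case: ifP.
apply/seteqP; split=> [x Ux|x [p /= pU px]]; last exact: pU.
have /nbhs_ballP[e /= e0 eU] := open_nbhs_nbhs (conj oU Ux).
(* The rational centre will lie within [rad] of [x], so the points of the box are within 2 [rad] < e
   of [x]. *)
have [m [rad radE [rad0 rade]]] : exists m : nat, exists2 rad : R,
    rad = m.+1%:R^-1 & 0 < rad /\ rad < e / 2.
  have e2 : 0 < e / 2 by rewrite divr_gt0.
  have [m _ /(_ m (leqnn _)) me] := near_infty_natSinv_lt (PosNum e2).
  by exists m, m.+1%:R^-1; rewrite ?invr_gt0.
have qx (j : 'I_d) : exists q : rat, `|x 0 j - ratr q| < rad.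
  have : x 0 j - rad < x 0 j + rad by lra.
  move=> /rat_in_itvoo[q]; rewrite in_itv /= => /andP[q1 q2].
  by exists q; rewrite ltr_norml; apply/andP; split; lra.
have [q qP] := choice qx.
exists (\row_j q j, m); rewrite /box /= -radE.
  move=> y [_ yb]; apply: eU; split=> // i j; rewrite ord1.
  have := yb 0 j; rewrite !mxE /ball /= => yq.
  have := qP j => xq.
  rewrite -[x 0 j](subrK (ratr (q j))) -addrA (le_lt_trans (ler_normD _ _))//.
  lra.
split=> // i j; rewrite !mxE ord1 /ball /= distrC; exact: qP.
Qed.

Lemma continuous_row_measurable (phi : 'rV[R]_d -> R) :
  continuous phi -> measurable_fun setT phi.
Proof.
move=> /continuousP cphi; apply: (measurability _ (RGenOpens.measurableE R)).
move=> _ [_ [a [b ->] <-]]; rewrite setTI; apply: open_row_measurable.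
exact/cphi/interval_open.
Qed.

Lemma gradient_measurable (L : R) (f : 'rV[R]_d -> R) :
  smooth L f -> measurable_fun setT (gradient f).
Proof.
move=> [fd fL]; apply/measurable_fun_rowP => j.
apply: continuous_row_measurable => x.
apply/(@cvgrPdist_le _ _ _ (nbhs x) (nbhs_filter x)) => e e0.
(* Balls are for the sup norm, while the Lipschitz bound is Euclidean, which costs a factor d in the
   squares. The added ones give c >= 1 even when L or d vanishes, so that L^2 d <= c <= c^2. *)
pose c : R := (L ^+ 2 + 1) * d.+1%:R.
have c0 : 0 < c by rewrite mulr_gt0// ltr_wpDl// sqr_ge0.
have r0 : 0 < e / c by rewrite divr_gt0.
have : nbhs x (ball x (e / c)) by exact: nbhsx_ballx.
apply: filterS => y [_ xyb].
have xy k : (x - y) 0 k ^+ 2 <= (e / c) ^+ 2.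
  rewrite -[leLHS]real_normK ?num_real// ler_sqr ?nnegrE ?(ltW r0)// !mxE.
  exact/ltW/xyb.
rewrite -ler_sqr ?nnegrE ?(ltW e0)// real_normK ?num_real//.
set g := gradient f x - gradient f y.
have -> : gradient f x 0 j - gradient f y 0 j = g 0 j by rewrite /g !mxE.
apply: (@le_trans _ _ (dot g g)).
  rewrite /dot (bigD1 j)//= -expr2 lerDl.
  by apply: sumr_ge0 => k _; rewrite -expr2 sqr_ge0.
apply: (@le_trans _ _ (L ^+ 2 * dot (x - y) (x - y))).
  rewrite -!sqr_enorm -exprMn ler_sqr ?nnegrE ?enorm_ge0 ?fL//.
  by apply: le_trans (fL x y); exact: enorm_ge0.
apply: (@le_trans _ _ (L ^+ 2 * (d%:R * (e / c) ^+ 2))).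
  apply: ler_wpM2l; first exact: sqr_ge0.
  rewrite -[d in d%:R]card_ord mulr_natl -sumr_const; apply: ler_sum => k _.
  by rewrite -expr2; exact: xy.
rewrite expr_div_n mulrA mulrA ler_pdivrMr ?exprn_gt0// mulrC.
apply: ler_wpM2l; first exact: sqr_ge0.
have L2 := sqr_ge0 L; have d0 := ler0n R d.
have Ld : 0 <= L ^+ 2 * d%:R by rewrite mulr_ge0.
have c1 : L ^+ 2 * d%:R <= c by rewrite /c -natr1; lra.
have c2 : 1 <= c by rewrite /c -natr1; lra.
by apply: le_trans c1 _; rewrite expr2 ler_peMl// ltW.
Qed.

End continuous_row_vectors.

(** * Averaging quadratic functions of a random vector *)

Section quadratic_functions.
Context {R : realType} {d : nat}.
Implicit Types (phi : 'rV[R]_d -> R) (b c u v : 'rV[R]_d).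

(** A quadratic polynomial with Hessian 2 a times the identity, given by its exact expansion at each
    point: the linear part may vary with [v], the coefficient [a] may not. *)
Definition quadratic (a : R) phi : Prop :=
  forall v, exists b, forall u, phi (v + u) = phi v + dot b u + a * dot u u.

Lemma eq_quadratic a1 a2 phi1 phi2 : a1 = a2 -> phi1 =1 phi2 ->
  quadratic a1 phi1 -> quadratic a2 phi2.
Proof. by move=> <- /funext <-. Qed.

Lemma quadratic_cst k : quadratic 0 (fun=> k).
Proof. by move=> v; exists 0 => u; rewrite dot0l mul0r !addr0. Qed.

Lemma quadratic_dot b : quadratic 0 (dot b).
Proof. by move=> v; exists b => u; rewrite dotDr mul0r addr0. Qed.

Lemma quadratic_sqr : quadratic 1 (fun v => dot v v).
Proof.
by move=> v; exists (2 *: v) => u; rewrite !dotE (dotC u v); ring.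
Qed.

Lemma quadraticD a1 a2 phi1 phi2 : quadratic a1 phi1 -> quadratic a2 phi2 ->
  quadratic (a1 + a2) (fun v => phi1 v + phi2 v).
Proof.
move=> q1 q2 v; have [b1 e1] := q1 v; have [b2 e2] := q2 v.
by exists (b1 + b2) => u; rewrite e1 e2 dotDl; ring.
Qed.

Lemma quadraticZ k a phi : quadratic a phi -> quadratic (k * a) (fun v => k * phi v).
Proof.
move=> q v; have [b e] := q v.
by exists (k *: b) => u; rewrite e dotZl; ring.
Qed.

Lemma quadratic_affine c k a phi : quadratic a phi ->
  quadratic (k ^+ 2 * a) (fun v => phi (c + k *: v)).
Proof.
move=> q v; have [b e] := q (c + k *: v).
by exists (k *: b) => u; rewrite scalerDr addrA e !dotE; ring.
Qed.

Lemma quadratic_sum (I : finType) (a : R) (k : I) (phi : I -> 'rV[R]_d -> R) :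
  (forall i, quadratic (if i == k then a else 0) (phi i)) ->
  quadratic a (fun v => \sum_i phi i v).
Proof.
move=> q v; have [b e] := choice (fun i => q i v).
exists (\sum_i b i) => u; under eq_bigr do rewrite e.
rewrite 2!big_split /=; congr (_ + _ + _).
  elim/big_rec2: _ => [|i x y _ ->]; first by rewrite dot0l.
  by rewrite dotDl.
rewrite (bigD1 k)//= eqxx big1 ?addr0// => i /negbTE ->; exact: mul0r.
Qed.

Context {dS : measure_display} {S : measurableType dS}.
Variables (nu : probability S R) (Y : S -> 'rV[R]_d) (v : 'rV[R]_d) (c : R).
Hypotheses (mY : measurable_fun setT Y)
  (EY : forall j, ('E_nu[fun s => (Y s 0 j)%R] = (v 0 j)%:E)%E)
  (VY : ('E_nu[fun s => (enorm (Y s - v) ^+ 2)%R] <= c%:E)%E).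

Let N s := dot (Y s - v) (Y s - v).

Let integrable_sqr_dist : nu.-integrable setT (EFin \o N).
Proof.
have mN : measurable_fun setT N.
  have mYv : measurable_fun setT (fun s => Y s - v).
    by apply: measurable_rowB => //; exact: measurable_cst.
  exact: measurable_dot.
apply/integrableP; split; first exact/measurable_EFinP.
apply: (@le_lt_trans _ _ c%:E); last exact: ltry.
move: VY; rewrite unlock; apply: le_trans; rewrite le_eqVlt; apply/orP; left.
apply/eqP/eq_integral => s _; rewrite sqr_enorm gee0_abs//.
by rewrite lee_fin dot_ge0.
Qed.

Let integrable_coord j : nu.-integrable setT (EFin \o (fun s => Y s 0 j)).
Proof.
have mYj : measurable_fun setT (fun s => Y s 0 j) by have /measurable_fun_rowP := mY.
(* By t <= 1 + t^2, the finite variance dominates each coordinate. *)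
pose g s : R := `|v 0 j| + 1 + N s.
apply: (@le_integrable _ _ _ _ _ _ _ (EFin \o g)) => //.
- exact/measurable_EFinP.
- move=> s _; rewrite /= lee_fin.
  have N0 : 0 <= N s by exact: dot_ge0.
  have Nj : (Y s 0 j - v 0 j) ^+ 2 <= N s.
    rewrite /N /dot (bigD1 j)//= -expr2 !mxE lerDl.
    by apply: sumr_ge0 => k _; rewrite -expr2 sqr_ge0.
  rewrite [leRHS]ger0_norm; last by rewrite !addr_ge0.
  apply: le_trans (_ : `|v 0 j| + `|Y s 0 j - v 0 j| <= _).
    by apply: le_trans (ler_normD _ _); rewrite addrC subrK.
  rewrite /g -addrA lerD2l.
  apply: le_trans (_ : 1 + (Y s 0 j - v 0 j) ^+ 2 <= _); last by rewrite lerD2l.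
  rewrite -[X in _ <= 1 + X]real_normK ?num_real//.
  have := sqr_ge0 (`|Y s 0 j - v 0 j| - 1); have := normr_ge0 (Y s 0 j - v 0 j).
  rewrite sqrrB1; lra.
- rewrite (_ : EFin \o g = (EFin \o cst (`|v 0 j| + 1)) \+ (EFin \o N))//.
  by apply: integrableD => //; exact: finite_measure_integrable_cst.
Qed.

(** Expand [phi] at the mean [v]: the linear term integrates to 0 by [EY], and the square is bounded
    by [VY]. *)
Lemma expectation_quadratic_le (a : R) (phi : 'rV[R]_d -> R) :
  0 <= a -> quadratic a phi ->
  (\int[nu]_s (phi (Y s))%:E <= (phi v + a * c)%:E)%E.
Proof.
move=> a0 qphi; have [b phiE] := qphi v.
pose l j s : R := b 0 j * (Y s 0 j - v 0 j).
have icst k : nu.-integrable setT (fun=> k%:E).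
  exact: finite_measure_integrable_cst.
have iY j : nu.-integrable setT (fun s => (Y s 0 j)%:E).
  exact: integrable_coord.
have iYv j : nu.-integrable setT (fun s => (Y s 0 j)%:E - (v 0 j)%:E)%E.
  exact: integrableB.
have il j : nu.-integrable setT (EFin \o l j).
  exact: (integrableZl measurableT _ (iYv j)).
have El j : (\int[nu]_s (l j s)%:E = 0)%E.
  under eq_integral do rewrite EFinM EFinB.
  rewrite integralZl// integralB//; have := EY j; rewrite unlock => ->.
  by rewrite integral_cst//= probability_setT mule1 subee// mule0.
have E s : (phi (Y s))%:E =
    ((phi v)%:E + ((\sum_j (l j s)%:E) + a%:E * (N s)%:E))%E.
  rewrite -EFinM sumEFin -!EFinD -[in LHS](subrK v (Y s)) [_ + v]addrC phiE.
  rewrite addrA.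
  by congr (_ + _ + _)%:E; apply: eq_bigr => j _; rewrite !mxE.
under eq_integral do rewrite E.
have ilin : nu.-integrable setT (fun s => \sum_j (l j s)%:E)%E.
  exact: (integrable_sum measurableT) (fun j _ => il j).
have iN : nu.-integrable setT (fun s => a%:E * (N s)%:E)%E.
  exact: (integrableZl measurableT _ integrable_sqr_dist).
rewrite integralD//; last exact: integrableD.
rewrite integral_cst//= probability_setT mule1 EFinD leeD2l//.
rewrite integralD// integral_sum//.
rewrite big1 ?add0e//; rewrite integralZl//.
rewrite EFinM; apply: lee_wpmul2l; first by rewrite lee_fin.
move: VY; rewrite unlock; apply: le_trans; rewrite le_eqVlt; apply/orP; left.
by apply/eqP/eq_integral => s _; rewrite sqr_enorm.
Qed.

End quadratic_functions.

(** * The potential function *)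

Section lyapunov.
Context {R : realType} {d n : nat}.
Variables (f : 'I_n -> 'rV[R]_d -> R) (Li : 'I_n -> R).
Variables (L Lmax mu omega alpha gamma : R) (xstar : 'rV[R]_d).
Implicit Types (x w g hbar : 'rV[R]_d) (h m : 'I_n -> 'rV[R]_d).

Let favg x := n%:R^-1 * \sum_(i < n) f i x.
Let grad_avg := gradient favg.
Let hstar i := gradient (f i) xstar.
Let beta := (omega + 1)^-1.

Definition server_weight := 3 * L / alpha.
Definition shift_weight := 8 * gamma * omega * (omega + 1) / n%:R ^+ 2.

Definition lyapunov x w h : R :=
  (2 * gamma)^-1 * dot (x - xstar) (x - xstar) + (favg x - favg xstar) +
  server_weight * dot (w - x) (w - x) +
  shift_weight * \sum_(i < n) dot (h i - hstar i) (h i - hstar i).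

(** Bounds the potential averaged over the server's draw: [x] and [h] are already updated, while [w]
    is still the old point. *)
Definition lyapunov_drawn x w h : R :=
  (2 * gamma)^-1 * dot (x - xstar) (x - xstar) + (favg x - favg xstar) +
  server_weight * ((1 - alpha) * dot (x - w) (x - w)) +
  shift_weight * \sum_(i < n) dot (h i - hstar i) (h i - hstar i).

(** The part of [lyapunov_drawn] at [x - gamma *: g] that involves [g], with [favg] replaced by its
    descent bound so as to be quadratic in [g]. *)
Definition majorant_step x w g : R :=
  (2 * gamma)^-1 * dot (x - xstar - gamma *: g) (x - xstar - gamma *: g) +
  (favg x - favg xstar - gamma * dot (grad_avg x) g +
     L * gamma ^+ 2 / 2 * dot g g) +
  server_weight * ((1 - alpha) * dot (x - w - gamma *: g) (x - w - gamma *: g)).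

Definition majorant x w h hbar m : R :=
  majorant_step x w (hbar + average m) +
  shift_weight * \sum_(i < n) dot (h i + beta *: m i - hstar i)
                                  (h i + beta *: m i - hstar i).

Definition step_curvature : R :=
  gamma / 2 + L * gamma ^+ 2 / 2 + server_weight * (1 - alpha) * gamma ^+ 2.

(** One message enters the gradient estimator with weight 1/n and its own shift with weight
    [beta]. *)
Definition worker_curvature : R :=
  step_curvature / n%:R ^+ 2 + shift_weight * beta ^+ 2.

Hypotheses (n_gt0 : (0 < n)%N) (L_ge0 : 0 <= L) (favg_smooth : smooth L favg).
Hypotheses (Li_ge0 : forall i, 0 <= Li i) (Li_le : forall i, Li i <= Lmax)
  (f_smooth : forall i, smooth (Li i) (f i))
  (f_convex : forall i, strongly_convex 0 (f i)).
Hypotheses (mu_ge0 : 0 <= mu) (favg_sc : strongly_convex mu favg)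
  (xstar_min : forall x, favg xstar <= favg x).
Hypotheses (omega_ge0 : 0 <= omega) (alpha_01 : 0 < alpha <= 1)
  (gamma_gt0 : 0 < gamma).
Hypotheses (gamma_Lmax : 160 * omega * Lmax * gamma <= n%:R)
  (gamma_L : 100 * L * gamma <= alpha)
  (gamma_mu : (omega + 1) * mu * gamma <= 1).

Let n0 : 0 < n%:R :> R. Proof. by rewrite ltr0n. Qed.
Let n_neq0 : n%:R != 0 :> R. Proof. by rewrite gt_eqF. Qed.
Let om1 : 0 < omega + 1. Proof. by rewrite ltr_wpDl. Qed.
Let alpha0 : 0 < alpha. Proof. by have /andP[] := alpha_01. Qed.
Let alpha1 : 0 <= 1 - alpha.
Proof. by rewrite subr_ge0; have /andP[] := alpha_01. Qed.
Let f_diff i x : differentiable (f i) x. Proof. by have [] := f_smooth i. Qed.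

Lemma server_weight_ge0 : 0 <= server_weight.
Proof. by rewrite divr_ge0 ?mulr_ge0// ltW. Qed.

Lemma shift_weight_ge0 : 0 <= shift_weight.
Proof. by rewrite divr_ge0 ?sqr_ge0// !mulr_ge0// ltW. Qed.

Lemma worker_curvature_ge0 : 0 <= worker_curvature.
Proof.
have g0 := ltW gamma_gt0; have s0 := server_weight_ge0.
have sh0 := shift_weight_ge0.
rewrite addr_ge0//; last by rewrite mulr_ge0// sqr_ge0.
rewrite divr_ge0 ?sqr_ge0// /step_curvature.
apply: addr_ge0; last by rewrite mulr_ge0 ?sqr_ge0// mulr_ge0.
by rewrite addr_ge0 ?divr_ge0// mulr_ge0// sqr_ge0.
Qed.

Lemma lyapunov_ge0 x w h : 0 <= lyapunov x w h.
Proof.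
apply: addr_ge0; last first.
  apply: mulr_ge0 shift_weight_ge0 _.
  by apply: sumr_ge0 => i _; exact: dot_ge0.
apply: addr_ge0; last exact: mulr_ge0 server_weight_ge0 (dot_ge0 _).
apply: addr_ge0; last by rewrite subr_ge0.
by rewrite mulr_ge0 ?dot_ge0// invr_ge0 mulr_ge0// ltW.
Qed.

Lemma lyapunov_drawn_ge0 x w h : 0 <= lyapunov_drawn x w h.
Proof.
apply: addr_ge0; last first.
  apply: mulr_ge0 shift_weight_ge0 _.
  by apply: sumr_ge0 => i _; exact: dot_ge0.
apply: addr_ge0; last first.
  by apply: mulr_ge0 server_weight_ge0 (mulr_ge0 alpha1 (dot_ge0 _)).
apply: addr_ge0; last by rewrite subr_ge0.
by rewrite mulr_ge0 ?dot_ge0// invr_ge0 mulr_ge0// ltW.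
Qed.

Lemma lyapunov_drawn_le x w h hbar m :
  lyapunov_drawn (x - gamma *: (hbar + average m)) w
    (fun i => h i + beta *: m i) <= majorant x w h hbar m.
Proof.
rewrite /lyapunov_drawn /majorant /majorant_step; move: (hbar + _) => g.
rewrite lerD2r [X in dot X X](_ : _ = x - xstar - gamma *: g) 1?addrAC//.
rewrite [X in server_weight * (_ * dot X X)](_ : _ = x - w - gamma *: g) 1?addrAC//.
rewrite lerD2r lerD2l.
have step := smooth_step_le gamma x g favg_smooth.
apply: le_trans (lerB step (lexx (favg xstar))) _; rewrite -/(grad_avg x).
by rewrite le_eqVlt; apply/orP; left; apply/eqP; ring.
Qed.

(** The sign is not visible on the formula, because of the linear term in [g]; it is inherited from
    the nonnegative quantity that [majorant] dominates. *)
Lemma majorant_ge0 x w h hbar m : 0 <= majorant x w h hbar m.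
Proof. exact: le_trans (lyapunov_drawn_ge0 _ _ _) (lyapunov_drawn_le _ _ _ _ _). Qed.

Lemma gradient_favg x : grad_avg x = average (fun i => gradient (f i) x).
Proof.
apply/rowP => j; rewrite /average /grad_avg /gradient !mxE summxE.
have -> : favg = n%:R^-1 *: \sum_(i < n) f i.
  by apply/funext => y; rewrite /favg fctE fct_sumE.
have fj i : derivable (f i) x (delta_mx 0 j) by exact/diff_derivable/f_diff.
rewrite deriveZ; last exact: derivable_sum.
by rewrite derive_sum//; congr (_ * _); apply: eq_bigr => i _; rewrite mxE.
Qed.

Lemma majorant_step_quadratic x w : quadratic step_curvature (majorant_step x w).
Proof.
have sq c : quadratic (gamma ^+ 2) (fun g => dot (c - gamma *: g) (c - gamma *: g)).
  apply: eq_quadratic (quadratic_affine c (- gamma) quadratic_sqr).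
    by rewrite sqrrN mulr1.
  by move=> g; rewrite scaleNr.
apply: eq_quadratic (quadraticD (quadraticD
  (quadraticZ (2 * gamma)^-1 (sq (x - xstar)))
  (quadraticD (quadraticD (quadratic_cst (favg x - favg xstar))
    (quadraticZ (- gamma) (quadratic_dot (grad_avg x))))
    (quadraticZ (L * gamma ^+ 2 / 2) quadratic_sqr)))
  (quadraticZ (server_weight * (1 - alpha)) (sq (x - w)))).
  by rewrite /step_curvature; field; rewrite gt_eqF.
by move=> g; rewrite /majorant_step; ring.
Qed.

Definition set_worker m k y i := if i == k then y else m i.

Lemma average_set_worker m k y :
  average (set_worker m k y) = average m - n%:R^-1 *: m k + n%:R^-1 *: y.
Proof.
rewrite /average -scalerBr -scalerDr (bigD1 k)//= [in RHS](bigD1 k)//=.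
rewrite [m k + _]addrC addrK addrC {2}/set_worker eqxx; congr (_ *: (_ + _)).
by apply: eq_bigr => i /negbTE ik; rewrite /set_worker ik.
Qed.

Lemma majorant_quadratic x w h hbar m (k : 'I_n) :
  quadratic worker_curvature (fun y => majorant x w h hbar (set_worker m k y)).
Proof.
have qs (i : 'I_n) : quadratic (if i == k then beta ^+ 2 else 0)
    (fun y => dot (h i + beta *: set_worker m k y i - hstar i)
                  (h i + beta *: set_worker m k y i - hstar i)).
  rewrite /set_worker; case: eqP => _; last exact: quadratic_cst.
  apply: eq_quadratic (quadratic_affine (h i - hstar i) beta quadratic_sqr).
    by rewrite mulr1.
  by move=> y; rewrite addrAC.
apply: eq_quadratic (quadraticD
  (quadratic_affine (hbar + (average m - n%:R^-1 *: m k)) n%:R^-1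
    (majorant_step_quadratic x w))
  (quadraticZ shift_weight (quadratic_sum qs))).
  by rewrite /worker_curvature exprVn mulrC.
by move=> y; rewrite /majorant average_set_worker !addrA.
Qed.

(** Sum the co-coercivity bounds: the linear terms of the Bregman divergences cancel, because the
    gradients at [xstar] average to 0. *)
Lemma grad_diff_sum_le w :
  \sum_(i < n) dot (gradient (f i) w - hstar i) (gradient (f i) w - hstar i) <=
  2 * Lmax * n%:R * (favg w - favg xstar).
Proof.
pose D i := f i w - f i xstar - dot (hstar i) (w - xstar).
have D0 i : 0 <= D i by exact: bregman_ge0.
have -> : 2 * Lmax * n%:R * (favg w - favg xstar) = \sum_(i < n) 2 * Lmax * D i.
  rewrite -mulr_sumr -mulrA; congr (_ * _).
  rewrite /D big_split /= big_split /= !sumrN.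
  have -> : \sum_(i < n) dot (hstar i) (w - xstar) = 0.
    transitivity (n%:R * dot (grad_avg xstar) (w - xstar)).
      rewrite gradient_favg /average dotZl mulVKf//.
      elim/big_rec2: _ => [|i u v _ ->]; first by rewrite dot0l.
      by rewrite dotDl.
    by rewrite /grad_avg (grad_min_eq0 L_ge0 favg_smooth xstar_min) dot0l mulr0.
  by rewrite subr0 mulrBr /favg !mulVKf.
apply: ler_sum => i _.
apply: le_trans (smooth_bregman_ge w xstar (Li_ge0 i) (f_smooth i) (f_convex i)) _.
by apply: ler_wpM2r; [exact: D0|rewrite ler_pM2l].
Qed.

(** With the messages at their means [delta], the gradient estimator is the exact gradient of [favg]
    at [w]. The sum over the workers is the accumulated price of replacing the drawn messages by
    these means. *)
Lemma lyapunov_contraction x w h hbar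
    (delta := fun i => gradient (f i) w - h i) :
  hbar = average h ->
  majorant x w h hbar delta +
    worker_curvature * omega * \sum_(i < n) dot (delta i) (delta i) <=
  (1 - gamma * mu / 2) * lyapunov x w h.
Proof.
move=> hbarE; pose p := grad_avg w; pose q := grad_avg x.
have gE : hbar + average delta = p.
  rewrite /p gradient_favg hbarE /average -scalerDr -big_split /=.
  by congr (_ *: _); apply: eq_bigr => i _; rewrite addrC subrK.
set D := \sum_(i < n) dot (delta i) (delta i).
pose H := \sum_(i < n) dot (h i - hstar i) (h i - hstar i).
pose G := \sum_(i < n) dot (gradient (f i) w - hstar i) (gradient (f i) w - hstar i).
have H0 : 0 <= H by apply: sumr_ge0 => i _; exact: dot_ge0.
have G0 : 0 <= G by apply: sumr_ge0 => i _; exact: dot_ge0.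
have shiftE : \sum_(i < n) dot (h i + beta *: delta i - hstar i)
      (h i + beta *: delta i - hstar i) + beta ^+ 2 * omega * D =
    (1 - beta) * H + beta * G.
  rewrite /H /G /D !mulr_sumr -!big_split /=; apply: eq_bigr => i _.
  (* This is where beta = 1/(omega + 1) is used: the variance term completes [dot_interpolation]
     exactly. *)
  have -> : beta ^+ 2 * omega = beta - beta ^+ 2.
    by rewrite /beta; field; rewrite gt_eqF.
  exact: dot_interpolation.
have hD : D <= 2 * G + 2 * H.
  rewrite /G /H /D !mulr_sumr -big_split /=; apply: ler_sum => i _.
  have := dot_sub_le (gradient (f i) w - hstar i) (h i - hstar i).
  by rewrite opprB addrA subrK.
pose X := dot (x - xstar) (x - xstar).
pose F := favg x - favg xstar.
pose E := dot (w - x) (w - x).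
pose W := dot (w - xstar) (w - xstar).
have F0 : 0 <= F by rewrite subr_ge0.
have E0 : 0 <= E := dot_ge0 _.
have hPX : F - L / 2 * E + mu / 2 * W <= dot p (x - xstar) :=
  grad_dot_ge x w xstar favg_smooth favg_sc.
have hW : X / 2 - E <= W.
  rewrite lerBlDr ler_pdivrMr// mulrDl ![_ * 2]mulrC.
  apply: le_trans (dot_sub_le (w - xstar) (w - x)).
  by rewrite opprB [w - _ + _]addrC addrA subrK.
have hmu : mu * E <= L * E :=
  strongly_convex_smooth_le x w favg_smooth favg_sc.
have pq := smooth_grad_dist w x favg_smooth.
rewrite -/(grad_avg w) -/(grad_avg x) -/p -/q -/E in pq.
have hQP : dot p p + dot q q - 2 * dot q p <= L ^+ 2 * E.
  by rewrite -dot_subE.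
have hPP : dot p p <= 2 * dot q q + 2 * L ^+ 2 * E.
  have := dot_sub_le q (q - p); rewrite opprB addrC subrK (dot_subC q p).
  by move=> /le_trans; apply; rewrite -mulrA; exact: (lerD (lexx _) (ler_wpM2l _ pq)).
have hQQ : dot q q <= 2 * L * F := smooth_grad_le x L_ge0 favg_smooth xstar_min.
have hEP : 0 <= alpha ^+ 2 * E - 4 * alpha * gamma * dot (w - x) p +
    4 * gamma ^+ 2 * dot p p.
  have := dot_young alpha (2 * gamma) (w - x) p.
  by rewrite -/E; congr (_ <= _); ring.
have hFw : favg w - favg xstar <= 2 * F + L * E :=
  smooth_gap_le x w L_ge0 favg_smooth xstar_min.
have hG := grad_diff_sum_le w; rewrite -/G in hG.
have := one_step_le gamma_gt0 L_ge0 (le_trans (Li_ge0 (Ordinal n_gt0)) (Li_le _))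
  mu_ge0 omega_ge0 alpha_01 n0 gamma_Lmax gamma_L gamma_mu (dot_ge0 (x - xstar))
  F0 E0 (dot_ge0 p) (dot_ge0 q) H0 G0 hPX hW hmu hQP hPP hQQ hEP hG hFw hD.
rewrite /majorant gE /majorant_step -/q -/server_weight -/shift_weight -/beta.
rewrite -/step_curvature -/D -/F -/X -/E -/H -/(lyapunov x w h) -shiftE.
have -> : dot (x - xstar - gamma *: p) (x - xstar - gamma *: p) =
    X - 2 * gamma * dot p (x - xstar) + gamma ^+ 2 * dot p p.
  exact: dot_subZE.
have -> : dot (x - w - gamma *: p) (x - w - gamma *: p) =
    E + 2 * gamma * dot (w - x) p + gamma ^+ 2 * dot p p.
  by rewrite dot_subZE /E (dot_subC w x) -(opprB x w) dotNl (dotC p); ring.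
by apply: le_trans; rewrite le_eqVlt; apply/orP; left; apply/eqP;
  rewrite /worker_curvature; ring.
Qed.

End lyapunov.

(** * Measurability of the potential and of its majorants *)

Section lyapunov_measurability.
Context {R : realType} {d n : nat} {dT : measure_display} {T : measurableType dT}.
Variables (f : 'I_n -> 'rV[R]_d -> R) (L mu omega alpha gamma : R).
Variable (xstar : 'rV[R]_d).
Let favg (x : 'rV[R]_d) := n%:R^-1 * \sum_(i < n) f i x.
Hypothesis favg_smooth : smooth L favg.
Variables (x w hbar : T -> 'rV[R]_d) (h m : T -> 'I_n -> 'rV[R]_d).
Hypotheses (mx : measurable_fun setT x) (mw : measurable_fun setT w)
  (mhbar : measurable_fun setT hbar)
  (mh : forall i, measurable_fun setT (fun z => h z i))
  (mm : forall i, measurable_fun setT (fun z => m z i)).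

Lemma measurable_gap : measurable_fun setT (fun z => favg (x z) - favg xstar).
Proof.
apply: measurable_funB => //; apply: measurableT_comp mx.
apply: continuous_row_measurable => y.
by apply: differentiable_continuous; have [] := favg_smooth.
Qed.

Lemma measurable_sqdist (u v : T -> 'rV[R]_d) :
  measurable_fun setT u -> measurable_fun setT v ->
  measurable_fun setT (fun z => dot (u z - v z) (u z - v z)).
Proof. by move=> mu' mv; apply: measurable_dot; exact: measurable_rowB. Qed.

Lemma measurable_lyapunov :
  measurable_fun setT (fun z =>
    lyapunov f L omega alpha gamma xstar (x z) (w z) (h z)).
Proof.
apply: measurable_funD; last first.
  apply: measurable_funM => //; apply: measurable_sum => i.
  exact: measurable_sqdist.
apply: measurable_funD; last by apply: measurable_funM => //; exact: measurable_sqdist.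
apply: measurable_funD measurable_gap.
by apply: measurable_funM => //; exact: measurable_sqdist.
Qed.

Lemma measurable_lyapunov_drawn :
  measurable_fun setT (fun z =>
    lyapunov_drawn f L omega alpha gamma xstar (x z) (w z) (h z)).
Proof.
apply: measurable_funD; last first.
  apply: measurable_funM => //; apply: measurable_sum => i.
  exact: measurable_sqdist.
apply: measurable_funD.
  apply: measurable_funD measurable_gap.
  by apply: measurable_funM => //; exact: measurable_sqdist.
by do 2![apply: measurable_funM => //]; exact: measurable_sqdist.
Qed.

Lemma measurable_majorant :
  measurable_fun setT (fun z =>
    majorant f L omega alpha gamma xstar (x z) (w z) (h z) (hbar z) (m z)).
Proof.
have mg : measurable_fun setT (fun z => hbar z + average (m z)).
  by apply: measurable_rowD => //; exact: measurable_average.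
have mgg := measurable_rowZ gamma mg.
apply: measurable_funD; last first.
  apply: measurable_funM => //; apply: measurable_sum => i.
  apply: measurable_sqdist => //; apply: measurable_rowD => //.
  exact: measurable_rowZ.
apply: measurable_funD; last first.
  do 2![apply: measurable_funM => //]; apply: measurable_sqdist => //.
  exact: measurable_rowB.
apply: measurable_funD.
  apply: measurable_funM => //; apply: measurable_sqdist => //.
  exact: measurable_rowB.
apply: measurable_funD; last first.
  by apply: measurable_funM => //; exact: measurable_dot.
apply: measurable_funB measurable_gap _.
apply: measurable_funM => //; apply: measurable_dot => //.
exact: measurableT_comp (gradient_measurable favg_smooth) mx.
Qed.

End lyapunov_measurability.

(** * Fresh draws *)

Section fresh_draws_theory.
Context {disp : measure_display} {Omega : measurableType disp} {R : realType}
  {P : probability Omega R} {d n : nat}.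
Variables (CD : 'I_n -> stochastic_map R d) (CP : stochastic_map R d).
Variables (xiD : forall (t : nat) (i : 'I_n), {RV P >-> seed (CD i)})
  (xiP : forall t : nat, {RV P >-> seed CP}).
Hypothesis xi_fresh : fresh_draws xiD xiP.

Definition draws : nat * option 'I_n -> set (set Omega) :=
  draw_sigma_algebra (fun t i => xiD t i) (fun t => xiP t).

Lemma draws_measurable k : draws k `<=` measurable.
Proof.
by case: k => t [i|] A [B mB <-]; [apply: (measurable_funPT (xiD t i))
  |apply: (measurable_funPT (xiP t))].
Qed.

Lemma draws_setT k : draws k setT.
Proof. by case: k => t [i|]; exists setT => //; rewrite setTI preimage_setT. Qed.

Lemma draws_setI k : setI_closed (draws k).
Proof.
by case: k => t [i|] _ _ [A mA <-] [B mB <-]; exists (A `&` B);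
  rewrite ?preimage_setI ?setTI//; exact: measurableI.
Qed.

(** The sample space itself with the smaller sigma-algebra of the draws in [K], so that depending
    only on those draws is plain measurability and the past is the identity map. *)
Definition pastT (K : set (nat * option 'I_n)) :=
  g_sigma_algebraType (past draws K).

Lemma measurable_to_pastT (K : set (nat * option 'I_n)) :
  measurable_fun [set: Omega] (id : Omega -> pastT K).
Proof.
move=> _ A mA; rewrite setTI.
exact: (sigma_past_measurable draws_measurable) mA.
Qed.

Definition to_pastT (K : set (nat * option 'I_n)) : {RV P >-> pastT K} :=
  HB.pack (id : Omega -> pastT K)
    (isMeasurableFun.Build _ _ _ _ _ (@measurable_to_pastT K)).

Lemma measurable_pastT_xiD (K : set (nat * option 'I_n)) t i : K (t, Some i) ->
  measurable_fun [set: pastT K] (xiD t i : pastT K -> seed (CD i)).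
Proof.
by move=> Kti _ A mA; apply: sub_sigma_algebra; exists (t, Some i) => //; exists A.
Qed.

Lemma measurable_pastT_xiP (K : set (nat * option 'I_n)) t : K (t, None) ->
  measurable_fun [set: pastT K] (xiP t : pastT K -> seed CP).
Proof.
by move=> Kt _ A mA; apply: sub_sigma_algebra; exists (t, None) => //; exists A.
Qed.

Lemma fresh_worker_le (K : set (nat * option 'I_n)) t i
    (g : pastT K * seed (CD i) -> \bar R) (h : pastT K -> \bar R) :
  ~ K (t, Some i) ->
  measurable_fun [set: pastT K * seed (CD i)] g -> (forall p, (0 <= g p)%E) ->
  measurable_fun [set: pastT K] h ->
  (forall z, (\int[seed_law (CD i)]_s g (z, s) <= h z)%E) ->
  (\int[P]_z g (z, xiD t i z) <= \int[P]_z h z)%E.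
Proof.
move=> Kti; have [lawD _ indep] := xi_fresh.
apply: (ge0_le_integral_freeze (X := to_pastT K) (Y := xiD t i)).
  exact: lawD.
move=> A B mA mB.
apply: (past_indep draws_measurable draws_setT draws_setI indep Kti mA).
by exists B; rewrite ?setTI.
Qed.

Lemma fresh_server_le (K : set (nat * option 'I_n)) t
    (g : pastT K * seed CP -> \bar R) (h : pastT K -> \bar R) :
  ~ K (t, None) ->
  measurable_fun [set: pastT K * seed CP] g -> (forall p, (0 <= g p)%E) ->
  measurable_fun [set: pastT K] h ->
  (forall z, (\int[seed_law CP]_s g (z, s) <= h z)%E) ->
  (\int[P]_z g (z, xiP t z) <= \int[P]_z h z)%E.
Proof.
move=> Kt; have [_ lawP indep] := xi_fresh.
apply: (ge0_le_integral_freeze (X := to_pastT K) (Y := xiP t)).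
  exact: lawP.
move=> A B mA mB.
apply: (past_indep draws_measurable draws_setT draws_setI indep Kt mA).
by exists B; rewrite ?setTI.
Qed.

End fresh_draws_theory.

Lemma measurable_stoch_fun {R : realType} {d : nat} (C : stochastic_map R d)
    {dT : measure_display} {T : measurableType dT}
    (v : T -> 'rV[R]_d) (xi : T -> seed C) :
  measurable_fun setT v -> measurable_fun setT xi ->
  measurable_fun setT (fun z => C (v z) (xi z)).
Proof.
move=> mv mxi; have mp := measurable_fun_pair mv mxi.
exact: (measurableT_comp (@stoch_measurable _ _ C) mp).
Qed.

(** * One iteration *)

Section iteration.
Context {R : realType} {d n : nat}.
Variables (f : 'I_n -> 'rV[R]_d -> R) (Li : 'I_n -> R).
Variables (L Lmax mu omega alpha gamma : R) (xstar : 'rV[R]_d).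
Let favg (x : 'rV[R]_d) := n%:R^-1 * \sum_(i < n) f i x.
Let beta := (omega + 1)^-1.
Hypotheses (n_gt0 : (0 < n)%N) (L_ge0 : 0 <= L) (favg_smooth : smooth L favg).
Hypotheses (Li_ge0 : forall i, 0 <= Li i) (Li_le : forall i, Li i <= Lmax)
  (f_smooth : forall i, smooth (Li i) (f i))
  (f_convex : forall i, strongly_convex 0 (f i)).
Hypotheses (mu_ge0 : 0 <= mu) (favg_sc : strongly_convex mu favg)
  (xstar_min : forall x, favg xstar <= favg x).
Hypotheses (omega_ge0 : 0 <= omega) (alpha_01 : 0 < alpha <= 1)
  (gamma_gt0 : 0 < gamma).
Hypotheses (gamma_Lmax : 160 * omega * Lmax * gamma <= n%:R)
  (gamma_L : 100 * L * gamma <= alpha)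
  (gamma_mu : (omega + 1) * mu * gamma <= 1).

Variables (CD : 'I_n -> stochastic_map R d) (CP : stochastic_map R d).
Hypotheses (CD_unbiased : forall i, unbiased_compressor omega (CD i))
  (CP_contractive : contractive_compressor alpha CP).
Context {disp : measure_display} {Omega : measurableType disp}
  {P : probability Omega R}.
Variables (xiD : forall (t : nat) (i : 'I_n), {RV P >-> seed (CD i)})
  (xiP : forall t : nat, {RV P >-> seed CP}).
Hypothesis xi_fresh : fresh_draws xiD xiP.
Variables (x0 : 'rV[R]_d) (h0 : 'I_n -> 'rV[R]_d).

Definition run z := diana_run f gamma beta x0 h0
  (fun t i v => CD i v (xiD t i z)) (fun t v => CP v (xiP t z)).
Let rx t z := iter_x (run z t).
Let rw t z := iter_w (run z t).
Let rh t z := iter_h (run z t).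
Let rhbar t z := iter_hbar (run z t).
Definition residual t z i := gradient (f i) (rw t z) - rh t z i.
Definition message t z i := CD i (residual t z i) (xiD t i z).

Lemma runS t z (g := rhbar t z + average (message t z)) :
  run z t.+1 = DianaState (rx t z - gamma *: g)
  (rw t z + CP (rx t z - gamma *: g - rw t z) (xiP t z))
  (fun i => rh t z i + beta *: message t z i)
  (rhbar t z + beta *: average (message t z)).
Proof.
by rewrite /g /message /residual /rx /rw /rh /rhbar /run /=; case: diana_run.
Qed.

Lemma rxS t z : rx t.+1 z = rx t z - gamma *: (rhbar t z + average (message t z)).
Proof. by rewrite {1}/rx runS. Qed.

Lemma rwS t z : rw t.+1 z = rw t z + CP (rx t.+1 z - rw t z) (xiP t z).
Proof. by rewrite rxS {1}/rw runS. Qed.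

Lemma rhS t z : rh t.+1 z = fun i => rh t z i + beta *: message t z i.
Proof. by rewrite {1}/rh runS. Qed.

Lemma rhbarS t z : rhbar t.+1 z = rhbar t z + beta *: average (message t z).
Proof. by rewrite {1}/rhbar runS. Qed.

Lemma rhbar_average t z : rhbar t z = average (rh t z).
Proof.
elim: t => [//|t IH]; rewrite rhbarS rhS IH /average big_split /= -scaler_sumr.
by rewrite scalerDr !scalerA mulrC.
Qed.

Notation pastT := (pastT xiD xiP).

Definition before t : set (nat * option 'I_n) := [set p | (p.1 < t)%N].

(** [K] is any superset of the earlier draws because, within an iteration, the past also contains
    some draws of that iteration. *)
Lemma measurable_run t (K : set (nat * option 'I_n)) : before t `<=` K ->
  [/\ measurable_fun [set: pastT K] (fun z => rx t z),
      measurable_fun [set: pastT K] (fun z => rw t z),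
      forall i, measurable_fun [set: pastT K] (fun z => rh t z i) &
      measurable_fun [set: pastT K] (fun z => rhbar t z)].
Proof.
elim: t => [_|t IH sK]; first by split=> [||i|]; exact: measurable_cst.
have [|mx mw mh mb] := IH.
  by move=> p pt; apply: sK; exact: ltn_trans pt (ltnSn t).
have mm i : measurable_fun [set: pastT K] (fun z => message t z i).
  apply: measurable_stoch_fun; last by apply: measurable_pastT_xiD; apply: sK; exact: ltnSn.
  apply: measurable_rowB => //.
  exact: measurableT_comp (gradient_measurable (f_smooth i)) mw.
have mavg : measurable_fun [set: pastT K] (fun z => average (message t z)).
  exact: measurable_average.
have mx' : measurable_fun [set: pastT K] (fun z => rx t.+1 z).
  under eq_fun do rewrite rxS.
  by apply: measurable_rowB => //; apply: measurable_rowZ; exact: measurable_rowD.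
split=> //.
- under eq_fun do rewrite rwS.
  apply: measurable_rowD => //; apply: measurable_stoch_fun.
    exact: measurable_rowB.
  by apply: measurable_pastT_xiP; apply: sK; exact: ltnSn.
- move=> i; under eq_fun do rewrite rhS.
  by apply: measurable_rowD => //; exact: measurable_rowZ.
- under eq_fun do rewrite rhbarS.
  by apply: measurable_rowD => //; exact: measurable_rowZ.
Qed.

Lemma measurable_residual t (K : set (nat * option 'I_n)) i : before t `<=` K ->
  measurable_fun [set: pastT K] (fun z => residual t z i).
Proof.
move=> /measurable_run[_ mw mh _]; apply: measurable_rowB => //.
exact: measurableT_comp (gradient_measurable (f_smooth i)) mw.
Qed.

Lemma measurable_message t (K : set (nat * option 'I_n)) i : before t `<=` K ->
  K (t, Some i) -> measurable_fun [set: pastT K] (fun z => message t z i).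
Proof.
move=> bK Kti; apply: measurable_stoch_fun; first exact: measurable_residual.
exact: measurable_pastT_xiD.
Qed.

Let V := lyapunov f L omega alpha gamma xstar.
Let V' := lyapunov_drawn f L omega alpha gamma xstar.
Let Q := majorant f L omega alpha gamma xstar.
Let curv := @worker_curvature R n L omega alpha gamma.

Let V_ge0 x w h : 0 <= V x w h.
Proof. exact: lyapunov_ge0. Qed.

Let Q_ge0 x w h hbar m : 0 <= Q x w h hbar m.
Proof. exact: majorant_ge0. Qed.

Let curv_ge0 : 0 <= curv.
Proof. exact: worker_curvature_ge0. Qed.

Definition lyapunov_run t z : R := V (rx t z) (rw t z) (rh t z).

Lemma measurable_pastT_Omega (K : set (nat * option 'I_n)) d' (S : measurableType d')
    (g : Omega -> S) :
  measurable_fun [set: pastT K] g -> measurable_fun [set: Omega] g.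
Proof.
move=> mg; have mid := @measurable_to_pastT _ _ _ _ _ _ _ _ xiD xiP K.
exact: (measurableT_comp mg mid).
Qed.

Lemma measurable_lyapunov_run t : measurable_fun [set: Omega] (lyapunov_run t).
Proof.
have [mx mw mh _] := @measurable_run t (before t) (@subset_refl _ _).
apply: (measurable_pastT_Omega (K := before t)).
exact: (measurable_lyapunov _ _ _ _ favg_smooth).
Qed.

(** Only the server term depends on the draw, and the new [w] minus [x] is exactly the compression
    error at [x - w]. *)
Lemma server_expectation_le x w h :
  (\int[seed_law CP]_s (V x (w + CP (x - w) s) h)%:E <= (V' x w h)%:E)%E.
Proof.
pose N s := dot (CP (x - w) s - (x - w)) (CP (x - w) s - (x - w)).
have VE s : (V x (w + CP (x - w) s) h)%:E =
    ((V x x h)%:E + (server_weight L alpha)%:E * (N s)%:E)%E.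
  have vE : w + CP (x - w) s - x = CP (x - w) s - (x - w).
    by rewrite opprB addrA [w + _]addrC.
  by rewrite -EFinM -EFinD /V /lyapunov subrr dot0l mulr0 addr0 vE addrAC.
under eq_integral do rewrite VE.
have mN : measurable_fun setT N.
  have mC : measurable_fun setT (fun s => CP (x - w) s).
    by apply: measurable_stoch_fun => //; exact: measurable_cst.
  by apply: measurable_sqdist => //; exact: measurable_cst.
have k0 := server_weight_ge0 L_ge0 alpha_01.
rewrite ge0_integralD//; last 3 first.
- by move=> s _; rewrite lee_fin.
- by move=> s _; rewrite -EFinM lee_fin mulr_ge0// dot_ge0.
- by apply/measurable_EFinP; exact: measurable_funM.
rewrite integral_cst//= probability_setT mule1.
have -> : V' x w h =
    V x x h + server_weight L alpha * ((1 - alpha) * dot (x - w) (x - w)).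
  by rewrite /V /V' /lyapunov /lyapunov_drawn subrr dot0l mulr0 addr0 addrAC.
rewrite [leRHS]EFinD; apply: leeD2l; rewrite ge0_integralZl_EFin//; last 2 first.
- by move=> s _; rewrite lee_fin dot_ge0.
- exact/measurable_EFinP.
rewrite [leRHS]EFinM; apply: lee_wpmul2l; rewrite ?lee_fin// -sqr_enorm.
have := CP_contractive (x - w); rewrite unlock; apply: le_trans.
rewrite le_eqVlt; apply/orP; left; apply/eqP/eq_integral => s _.
by rewrite sqr_enorm.
Qed.

Lemma server_draw_le t :
  (\int[P]_z (lyapunov_run t.+1 z)%:E <=
   \int[P]_z (Q (rx t z) (rw t z) (rh t z) (rhbar t z) (message t z))%:E)%E.
Proof.
(* The past of the server's draw includes all worker draws of iteration [t], so the new [x] and the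
   new shifts are frozen. *)
pose K := [set p : nat * option 'I_n | (p.1 < t)%N \/ p.1 = t /\ p.2 != None].
have bK : before t `<=` K by move=> p; left.
have [mx mw mh mb] := measurable_run bK.
have mm i : measurable_fun [set: pastT K] (fun z => message t z i).
  by apply: measurable_message => //; right.
have mx' : measurable_fun [set: pastT K] (fun z => rx t.+1 z).
  under eq_fun do rewrite rxS.
  apply: measurable_rowB => //; apply: measurable_rowZ; apply: measurable_rowD => //.
  exact: measurable_average.
have mh' i : measurable_fun [set: pastT K] (fun z => rh t.+1 z i).
  under eq_fun do rewrite rhS.
  by apply: measurable_rowD => //; exact: measurable_rowZ.
pose g (p : pastT K * seed CP) := (V (rx t.+1 p.1)
  (rw t p.1 + CP (rx t.+1 p.1 - rw t p.1) p.2) (rh t.+1 p.1))%:E.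
pose h (z : pastT K) := (V' (rx t.+1 z) (rw t z) (rh t.+1 z))%:E.
have gE z : (lyapunov_run t.+1 z)%:E = g (z, xiP t z).
  by rewrite /lyapunov_run rwS.
under eq_integral do rewrite gE.
apply: (@le_trans _ _ (\int[P]_z h z)%E).
  apply: (fresh_server_le xi_fresh).
  - by move=> [/= |[//]]; rewrite ltnn.
  - have m1 dS (S : measurableType dS) (u : pastT K -> S) :
        measurable_fun setT u -> measurable_fun [set: pastT K * seed CP] (u \o fst).
      by move=> mu'; exact: measurableT_comp mu' measurable_fst.
    apply/measurable_EFinP; apply: measurable_lyapunov => //.
    + exact: (m1 _ _ _ mx').
    + apply: measurable_rowD; first exact: (m1 _ _ _ mw).
      apply: measurable_stoch_fun => //; apply: measurable_rowB.
        exact: (m1 _ _ _ mx').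
      exact: (m1 _ _ _ mw).
    + by move=> i; exact: (m1 _ _ _ (mh' i)).
  - by move=> p; rewrite lee_fin.
  - by apply/measurable_EFinP; exact: measurable_lyapunov_drawn.
  - by move=> z; exact: (server_expectation_le (rx t.+1 z) (rw t z) (rh t.+1 z)).
apply: ge0_le_integral => //.
- by move=> z _; rewrite lee_fin; exact: lyapunov_drawn_ge0.
- apply: (measurable_pastT_Omega (K := K)); apply/measurable_EFinP.
  exact: measurable_lyapunov_drawn.
- apply: (measurable_pastT_Omega (K := K)); apply/measurable_EFinP.
  exact: measurable_majorant.
- by move=> z _; rewrite lee_fin rxS rhS; exact: lyapunov_drawn_le.
Qed.

Lemma worker_expectation_le x w h hbar m (k : 'I_n) v :
  (\int[seed_law (CD k)]_s (Q x w h hbar (set_worker m k (CD k v s)))%:E <=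
   (Q x w h hbar (set_worker m k v) + curv * (omega * dot v v))%:E)%E.
Proof.
have [Ev Vv] := CD_unbiased k v.
rewrite -sqr_enorm.
apply: (expectation_quadratic_le (phi := fun y => Q x w h hbar (set_worker m k y))
  _ Ev Vv curv_ge0).
  by apply: measurable_stoch_fun => //; exact: measurable_cst.
exact: majorant_quadratic.
Qed.

Definition partial_message t j z (i : 'I_n) :=
  if (i < j)%N then message t z i else residual t z i.

(** Hybrid between the drawn messages (j = n) and their means (j = 0): workers from [j] on send
    their mean and are charged the variance this removes. *)
Definition partial_cost t j z : R :=
  Q (rx t z) (rw t z) (rh t z) (rhbar t z) (partial_message t j z) +
  curv * omega * \sum_(i < n | (j <= i)%N) dot (residual t z i) (residual t z i).

Lemma partial_cost_ge0 t j z : 0 <= partial_cost t j z.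
Proof.
rewrite addr_ge0// !mulr_ge0//.
by apply: sumr_ge0 => i _; exact: dot_ge0.
Qed.

Lemma measurable_partial_message t j (K : set (nat * option 'I_n)) :
  before t `<=` K -> (forall i : 'I_n, (i < j)%N -> K (t, Some i)) ->
  forall i, measurable_fun [set: pastT K] (fun z => partial_message t j z i).
Proof.
move=> bK jK i; have [ij|ij] := boolP (i < j)%N.
  under eq_fun do rewrite /partial_message ij.
  exact: measurable_message (jK _ ij).
under eq_fun do rewrite /partial_message (negPf ij).
exact: measurable_residual.
Qed.

Lemma measurable_residual_tail t j (K : set (nat * option 'I_n)) :
  before t `<=` K -> measurable_fun [set: pastT K] (fun z =>
    curv * omega * \sum_(i < n | (j <= i)%N) dot (residual t z i) (residual t z i)).
Proof.
move=> bK; apply: measurable_funM => //.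
under eq_fun do rewrite big_mkcond.
apply: measurable_sum => i; case: (j <= i)%N; last exact: measurable_cst.
by apply: measurable_dot; exact: measurable_residual.
Qed.

Lemma measurable_partial_cost t j (K : set (nat * option 'I_n)) :
  before t `<=` K -> (forall i : 'I_n, (i < j)%N -> K (t, Some i)) ->
  measurable_fun [set: pastT K] (partial_cost t j).
Proof.
move=> bK jK; have [mx mw mh mb] := measurable_run bK.
apply: measurable_funD; last exact: measurable_residual_tail.
by apply: (measurable_majorant _ _ _ _ favg_smooth) => //;
  exact: measurable_partial_message.
Qed.

(** The two hybrids differ only at worker [k]. Integrating out its draw turns the message into its
    mean at a price that is exactly the new summand of the tail. *)
Lemma worker_draw_le t (k : 'I_n) :
  (\int[P]_z (partial_cost t k.+1 z)%:E <= \int[P]_z (partial_cost t k z)%:E)%E.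
Proof.
(* Only the draws of workers before [k] are frozen; later workers already send residuals, which
   depend on earlier iterations alone. *)
pose K := [set p : nat * option 'I_n | (p.1 < t)%N \/
  p.1 = t /\ exists2 i : 'I_n, p.2 = Some i & (i < k)%N].
have bK : before t `<=` K by move=> p; left.
have kK (i : 'I_n) : (i < k)%N -> K (t, Some i) by right; split=> //; exists i.
have [mx mw mh mb] := measurable_run bK.
pose tail j z :=
  curv * omega * \sum_(i < n | (j <= i)%N) dot (residual t z i) (residual t z i).
have tail_ge0 j z : 0 <= tail j z.
  by rewrite !mulr_ge0//; apply: sumr_ge0 => i _; exact: dot_ge0.
have tailE z : tail k z =
    curv * (omega * dot (residual t z k) (residual t z k)) + tail k.+1 z.
  rewrite /tail (bigD1 k)//= mulrDr -!mulrA; congr (_ + _ * (_ * _)).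
  by apply: eq_bigl => i; rewrite ltn_neqAle andbC eq_sym.
have setE y z : set_worker (partial_message t k z) k y =
    fun i => if i == k then y else partial_message t k z i by [].
have costE z : partial_cost t k.+1 z = Q (rx t z) (rw t z) (rh t z) (rhbar t z)
    (set_worker (partial_message t k z) k (message t z k)) + tail k.+1 z.
  congr (Q _ _ _ _ _ + _); apply/funext => i; rewrite setE /partial_message.
  by rewrite ltnS leq_eqVlt val_eqE; case: eqVneq => [->|].
have resE z : partial_message t k z =
    set_worker (partial_message t k z) k (residual t z k).
  apply/funext => i; rewrite setE; case: eqP => // ->.
  by rewrite /partial_message ltnn.
pose g (p : pastT K * seed (CD k)) :=
  (Q (rx t p.1) (rw t p.1) (rh t p.1) (rhbar t p.1)
    (set_worker (partial_message t k p.1) k (CD k (residual t p.1 k) p.2)) +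
   tail k.+1 p.1)%:E.
have gE z : (partial_cost t k.+1 z)%:E = g (z, xiD t k z) by rewrite costE.
under eq_integral do rewrite gE.
have m1 dS (S : measurableType dS) (u : pastT K -> S) :
    measurable_fun setT u -> measurable_fun [set: pastT K * seed (CD k)] (u \o fst).
  by move=> mu'; exact: measurableT_comp mu' measurable_fst.
have mtail j : measurable_fun [set: pastT K] (tail j) by exact: measurable_residual_tail.
have mset (i : 'I_n) : measurable_fun [set: pastT K * seed (CD k)] (fun p =>
    set_worker (partial_message t k p.1) k (CD k (residual t p.1 k) p.2) i).
  rewrite /set_worker; case: eqP => _.
    apply: measurable_stoch_fun => //.
    exact: (m1 _ _ _ (measurable_residual k bK)).
  exact: (m1 _ _ _ (measurable_partial_message bK kK i)).
have mQ : measurable_fun [set: pastT K * seed (CD k)] (fun p =>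
    Q (rx t p.1) (rw t p.1) (rh t p.1) (rhbar t p.1)
    (set_worker (partial_message t k p.1) k (CD k (residual t p.1 k) p.2))).
  apply: (measurable_majorant _ _ _ _ favg_smooth) => //.
  - exact: (m1 _ _ _ mx).
  - exact: (m1 _ _ _ mw).
  - exact: (m1 _ _ _ mb).
  - by move=> i; exact: (m1 _ _ _ (mh i)).
apply: (fresh_worker_le xi_fresh (K := K)).
- by move=> [/= |[_ [i [<-]]]]; rewrite ltnn.
- apply/measurable_EFinP; apply: measurable_funD mQ _.
  exact: (m1 _ _ _ (mtail k.+1)).
- by move=> p; rewrite lee_fin addr_ge0.
- by apply/measurable_EFinP; exact: measurable_partial_cost.
- move=> z; rewrite /g /=.
  have mz : measurable_fun [set: seed (CD k)] (fun s =>
      Q (rx t z) (rw t z) (rh t z) (rhbar t z)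
      (set_worker (partial_message t k z) k (CD k (residual t z k) s))).
    exact: (measurableT_comp mQ (pair1_measurable z)).
  under eq_integral do rewrite EFinD.
  rewrite ge0_integralD//; last 3 first.
  + by move=> s _; rewrite lee_fin.
  + exact/measurable_EFinP.
  + by move=> s _; rewrite lee_fin.
  rewrite integral_cst//= probability_setT mule1.
  apply: le_trans (leeD2r _ (worker_expectation_le _ _ _ _ _ _ _)) _.
  rewrite -resE -EFinD lee_fin -addrA -tailE.
  exact: lexx.
Qed.

Lemma all_workers_draw_le t :
  (\int[P]_z (Q (rx t z) (rw t z) (rh t z) (rhbar t z) (message t z))%:E <=
   \int[P]_z (partial_cost t 0 z)%:E)%E.
Proof.
have le j : (j <= n)%N ->
    (\int[P]_z (partial_cost t j z)%:E <= \int[P]_z (partial_cost t 0 z)%:E)%E.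
  elim: j => [//|j IH jn]; apply: le_trans (IH (ltnW jn)).
  exact: (worker_draw_le t (Ordinal jn)).
apply: le_trans (le n (leqnn n)); rewrite le_eqVlt; apply/orP; left.
apply/eqP/eq_integral => z _; congr EFin.
rewrite /partial_cost big_pred0; last by move=> i; rewrite leqNgt ltn_ord.
rewrite mulr0 addr0; congr Q.
by apply/funext => i; rewrite /partial_message ltn_ord.
Qed.

Let rate_ge0 : 0 <= 1 - gamma * mu / 2.
Proof.
have : mu * gamma <= 1.
  apply: le_trans gamma_mu; rewrite -mulrA ler_peMl ?lerDr//.
  by rewrite mulr_ge0// ltW.
by rewrite subr_ge0 ler_pdivrMr// mul1r mulrC => /le_trans; apply; rewrite ler1n.
Qed.

Lemma lyapunov_step t :
  (\int[P]_z (lyapunov_run t.+1 z)%:E <=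
   (1 - gamma * mu / 2)%:E * \int[P]_z (lyapunov_run t z)%:E)%E.
Proof.
apply: le_trans (server_draw_le t) _; apply: le_trans (all_workers_draw_le t) _.
rewrite -ge0_integralZl_EFin//; last 2 first.
- by move=> z _; rewrite lee_fin; exact: V_ge0.
- by apply/measurable_EFinP; exact: measurable_lyapunov_run.
apply: ge0_le_integral => //.
- by move=> z _; rewrite lee_fin partial_cost_ge0.
- apply/measurable_EFinP.
  apply: (measurable_pastT_Omega (K := before t)).
  exact: measurable_partial_cost.
- by apply: measurable_funeM; apply/measurable_EFinP; exact: measurable_lyapunov_run.
move=> z _; rewrite -EFinM lee_fin /partial_cost.
rewrite (eq_bigl xpredT)//.
have := lyapunov_contraction n_gt0 L_ge0 favg_smooth Li_ge0 Li_le f_smooth f_convex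
  mu_ge0 favg_sc xstar_min omega_ge0 alpha_01 gamma_gt0 gamma_Lmax gamma_L gamma_mu
  (rx t z) (rw t z) (rhbar_average t z).
exact.
Qed.

Lemma lyapunov_run_le t :
  (\int[P]_z (lyapunov_run t z)%:E <=
   ((1 - gamma * mu / 2) ^+ t)%:E * \int[P]_z (lyapunov_run 0 z)%:E)%E.
Proof.
elim: t => [|t IH]; first by rewrite expr0 mul1e.
apply: le_trans (lyapunov_step t) _; rewrite exprS EFinM -muleA.
by apply: lee_wpmul2l IH; rewrite lee_fin.
Qed.

End iteration.

(** * Stepsize conditions and conclusion *)

Lemma bound_quotient_le {R : realType} (g a b : R) : 0 <= a -> 0 <= b ->
  (g%:E <= bound_quotient a b)%E -> b * g <= a.
Proof.
move=> a0 b0; rewrite /bound_quotient; have [->|b_neq0] := eqVneq b 0.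
  by rewrite mul0r.
by rewrite lee_fin ler_pdivlMr ?lt_neqAle 1?eq_sym ?b_neq0// mulrC.
Qed.

Theorem theorem5p1 (R : realType) (d n : nat) (n_gt0 : (0 < n)%N)
  (f : 'I_n -> 'rV[R]_d -> R)
  (favg := (fun x : 'rV[R]_d => n%:R^-1 * \sum_(i < n) f i x) : 'rV[R]_d -> R)
  (f_diff : forall i x, differentiable (f i) x)
  (L : R) (L_smooth : smoothness_constant L favg)
  (Li : 'I_n -> R) (Li_smooth : forall i, smoothness_constant (Li i) (f i))
  (Lmax := \big[Num.max/0]_(i < n) Li i)
  (f_convex : forall i, convex_function (E := 'rV[R]_d) setT (f i))
  (mu : R) (mu_ge0 : 0 <= mu) (favg_sc : strongly_convex mu favg)
  (xstar : 'rV[R]_d) (xstar_min : forall x, favg xstar <= favg x)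
  (omega : R) (omega_ge0 : 0 <= omega)
  (alpha : R) (alpha_01 : 0 < alpha <= 1)
  (CD : 'I_n -> stochastic_map R d)
  (CD_unbiased : forall i, unbiased_compressor omega (CD i))
  (CP : stochastic_map R d) (CP_contractive : contractive_compressor alpha CP)
  (disp : measure_display) (Omega : measurableType disp)
  (P : probability Omega R)
  (xiD : forall (t : nat) (i : 'I_n), {RV P >-> seed (CD i)})
  (xiP : forall t : nat, {RV P >-> seed CP})
  (xi_fresh : fresh_draws xiD xiP)
  (x0 : 'rV[R]_d) (h0 : 'I_n -> 'rV[R]_d)
  (beta := (omega + 1)^-1)
  (gamma : R) (gamma_gt0 : 0 < gamma)
  (gamma_le : (gamma%:E <=
     mine (bound_quotient n%:R (160 * omega * Lmax))
       (mine (bound_quotient alpha (100 * L))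
             (bound_quotient 1 ((omega + 1) * mu))))%E)
  (x := diana_x f gamma beta x0 h0 (fun t i => xiD t i) (fun t => xiP t))
  (V0 := (((2 * gamma)^-1)%:E * 'E_P[fun z => (enorm (x 0%N z - xstar) ^+ 2)%R]
          + (favg x0 - favg xstar)%:E
          + (8 * gamma * omega * (omega + 1) / n%:R ^+ 2
             * \sum_(i < n) enorm (h0 i - gradient (f i) xstar) ^+ 2)%:E)%E)
  (T : nat) :
  (((2 * gamma)^-1)%:E * 'E_P[fun z => (enorm (x T z - xstar) ^+ 2)%R]
     + 'E_P[fun z => (favg (x T z) - favg xstar)%R]
   <= ((1 - gamma * mu / 2) ^+ T)%:E * V0)%E.
Proof.
have [L_ge0 favg_smooth _] := L_smooth.
have Li_ge0 i : 0 <= Li i by have [] := Li_smooth i.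
have f_smooth i : smooth (Li i) (f i) by have [] := Li_smooth i.
have f_sc i : strongly_convex 0 (f i) by exact: convex_strongly_convex.
have Li_le i : Li i <= Lmax by exact: le_bigmax.
have Lmax_ge0 : 0 <= Lmax by exact: le_trans (Li_le (Ordinal n_gt0)).
have om1_ge0 : 0 <= omega + 1 by rewrite addr_ge0.
have [alpha_gt0 _] := andP alpha_01.
move: gamma_le; rewrite !le_min => /and3P[le1 le2 le3].
have gamma_Lmax : 160 * omega * Lmax * gamma <= n%:R.
  by apply: bound_quotient_le le1; rewrite ?mulr_ge0.
have gamma_L : 100 * L * gamma <= alpha.
  by apply: bound_quotient_le le2; [exact: ltW|rewrite mulr_ge0].
have gamma_mu : (omega + 1) * mu * gamma <= 1.
  by apply: bound_quotient_le le3; rewrite ?mulr_ge0.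
pose V := lyapunov_run f L omega alpha gamma xstar xiD xiP x0 h0.
have Vle : (\int[P]_z (V T z)%:E <=
    ((1 - gamma * mu / 2) ^+ T)%:E * \int[P]_z (V 0%N z)%:E)%E.
  exact: (lyapunov_run_le n_gt0 L_ge0 favg_smooth Li_ge0 Li_le f_smooth f_sc).
have -> : V0 = (\int[P]_z (V 0%N z)%:E)%E.
  transitivity (lyapunov f L omega alpha gamma xstar x0 x0 h0)%:E; last first.
    have V0E z : V 0%N z = lyapunov f L omega alpha gamma xstar x0 x0 h0 by [].
    by under eq_integral do rewrite V0E; rewrite integral_cst//= probability_setT mule1.
  rewrite /V0; have -> : ('E_P[fun z => (enorm (x 0%N z - xstar) ^+ 2)%R] =
      (dot (x0 - xstar) (x0 - xstar))%:E)%E.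
    rewrite unlock -sqr_enorm; have x0E z : x 0%N z = x0 by [].
    by under eq_integral do rewrite x0E; rewrite integral_cst//= probability_setT mule1.
  rewrite /lyapunov subrr dot0l mulr0 addr0 -EFinM -!EFinD.
  by congr (_ + _ * _)%:E; apply: eq_bigr => i _; rewrite sqr_enorm.
apply: le_trans Vle.
have [mx _ _ _] := measurable_run omega gamma f_smooth xiD xiP x0 h0
  (@subsetT _ (before T)).
have mxT : measurable_fun [set: Omega] (x T) := measurable_pastT_Omega mx.
have mD : measurable_fun [set: Omega] (fun z => dot (x T z - xstar) (x T z - xstar)).
  by apply: measurable_sqdist => //; exact: measurable_cst.
have mG : measurable_fun [set: Omega] (fun z => favg (x T z) - favg xstar).
  exact: (measurable_gap _ favg_smooth).
have g0 : 0 <= (2 * gamma)^-1 by rewrite invr_ge0 mulr_ge0// ltW.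
rewrite unlock -ge0_integralZl_EFin//; last 2 first.
- by move=> z _; rewrite lee_fin sqr_ge0.
- by apply/measurable_EFinP; under eq_fun do rewrite sqr_enorm.
rewrite -ge0_integralD//; last 4 first.
- by move=> z _; rewrite -EFinM lee_fin mulr_ge0// sqr_ge0.
- apply: measurable_funeM; apply/measurable_EFinP.
  by under eq_fun do rewrite sqr_enorm.
- by move=> z _; rewrite lee_fin subr_ge0.
- exact/measurable_EFinP.
apply: ge0_le_integral => //.
- move=> z _; rewrite -EFinM -EFinD lee_fin addr_ge0 ?subr_ge0//.
  by rewrite mulr_ge0// sqr_ge0.
- apply: emeasurable_funD; last exact/measurable_EFinP.
  apply: measurable_funeM; apply/measurable_EFinP.
  by under eq_fun do rewrite sqr_enorm.
- apply/measurable_EFinP; exact: measurable_lyapunov_run.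
(* Pointwise, the left side is the potential without its nonnegative server and shift terms. *)
move=> z _; rewrite -EFinM -EFinD lee_fin sqr_enorm.
rewrite /V /lyapunov_run /lyapunov -addrA lerDl addr_ge0//.
  by rewrite mulr_ge0 ?dot_ge0// server_weight_ge0.
rewrite mulr_ge0 ?shift_weight_ge0//; apply: sumr_ge0 => i _.
exact: dot_ge0.
Qed.
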